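(* Let $T>0$, $r\ge0$, and let $(S_t)_{t\in[0,T]}$ be a continuous semimartingale on a filtered probability space $(\Omega,\mathcal F,(\mathcal F_t)_{t\in[0,T]},\mathbb P)$ such that $\mathbb P(S_t>0\ \forall t\in[0,T])=1$ and $(\mathrm e^{-rt}S_t)_{t\in[0,T]}$ is a $\mathbb P$-martingale. Let $g$ be a Borel probability measure on $[0,T]$ and define $G_t=\exp(\int_{[0,t]}\log(S_u)\,g(\mathrm du))$ and $G_{t,T}=\exp(\int_{(t,T]}\log(S_u)\,g(\mathrm du))$. Let $R\in(0,1)$ and let $h:\mathbb R_+^2\to\mathbb R$ admit the representation $$h(x,y)=a+bx+cy+\int_{\mathcal S_R}x^z\,\zeta_0(\mathrm dz)+\int_{\mathcal S_R}x^zy^{1-z}\,\zeta_1(\mathrm dz),\qquad x,y>0,$$ where $a,b,c\in\mathbb R$, $\zeta_0,\zeta_1$ are finite complex Borel measures on $\mathcal S_R$, and the integrals are real-valued. Put $H_t^h:=\mathrm e^{-r(T-t)}\mathbb E[h(G_T,S_T)\mid\mathcal F_t]$ and $\Psi_t(s,w):=\mathbb E[G_{t,T}^sS_T^w\mid\mathcal F_t]$. Then, for every $t\in[0,T]$, $$H_t^h=\mathrm e^{-r(T-t)}a+\mathrm e^{-r(T-t)}bG_t\Psi_t(1,0)+cS_t+\mathrm e^{-r(T-t)}\int_{\mathcal S_R}G_t^z\Psi_t(z,0)\,\zeta_0(\mathrm dz)+\mathrm e^{-r(T-t)}\int_{\mathcal S_R}G_t^z\Psi_t(z,1-z)\,\zeta_1(\mathrm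 dz),$$ and the two integrals are absolutely convergent almost surely.
   Context: $\mathcal S_R:=\{R+\mathrm iy:y\in\mathbb R\}$ is the vertical line in $\mathbb C$ with real part $R$. For $x>0$ and $z\in\mathbb C$, $x^z=\exp(z\log x)$. $G_T$ is $G_t$ at $t=T$, so $G_T=G_tG_{t,T}$. *)

(* Defs.v *)
From HB Require Import structures.
From mathcomp Require Import all_boot all_order all_algebra.
From mathcomp Require Import all_classical all_reals all_analysis.
From mathcomp Require Import complex.

Set Implicit Arguments.
Unset Strict Implicit.
Unset Printing Implicit Defensive.

Import Order.TTheory GRing.Theory Num.Theory.
Import numFieldNormedType.Exports.

Local Open Scope classical_set_scope.
Local Open Scope ring_scope.
Local Open Scope complex_scope.

Section Complex_numbers.
Context {R : realType}.
Implicit Types (x : R) (z : R[i]).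

Definition cexp z : R[i] :=
  (expR (complex.Re z))%:C * (cos (complex.Im z) +i* sin (complex.Im z)).

(* Meaningful for x > 0 only: ln x = 0 when x <= 0. *)
Definition cpow x z : R[i] := cexp (z * (ln x)%:C).

End Complex_numbers.

Section Complex_measures.
Context {d : measure_display} {T : measurableType d} {R : realType}.
Implicit Types nu : {charge set T -> \bar R}.

Lemma charge_hahn_ex nu :
  exists PN : set T * set T, hahn_decomposition nu PN.1 PN.2.
Proof. by have [P [N PN]] := Hahn_decomposition nu; exists (P, N). Qed.

(* The Jordan decomposition does not depend on the Hahn decomposition chosen. *)
Definition charge_hahn nu := svalP (cid (charge_hahn_ex nu)).

Definition charge_integrable nu (f : T -> R) : Prop :=
  (charge_variation (charge_hahn nu)).-integrable setT (EFin \o f).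

Definition charge_integral nu (f : T -> R) : R :=
  \int[jordan_pos (charge_hahn nu)]_x f x
  - \int[jordan_neg (charge_hahn nu)]_x f x.

(* Charges of the library are finite signed measures, so a pair of charges is
   a finite complex measure. *)
Record complex_measure := ComplexMeasure {
  cm_re : {charge set T -> \bar R} ;
  cm_im : {charge set T -> \bar R} }.

(* Absolute convergence of the integral of f with respect to
   zeta = cm_re + i cm_im, that is, L^1(zeta) = L^1(cm_re) /\ L^1(cm_im). Since
   |zeta| <= |cm_re| + |cm_im| <= 2 |zeta|, this says that |f| has a finite
   integral with respect to the total variation |zeta|. *)
Definition cintegrable (zeta : complex_measure) (f : T -> R[i]) : Prop :=
  [/\ charge_integrable (cm_re zeta) (fun x => complex.Re (f x)),
      charge_integrable (cm_re zeta) (fun x => complex.Im (f x)),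
      charge_integrable (cm_im zeta) (fun x => complex.Re (f x)) &
      charge_integrable (cm_im zeta) (fun x => complex.Im (f x))].

Definition cintegral (zeta : complex_measure) (f : T -> R[i]) : R[i] :=
  (charge_integral (cm_re zeta) (fun x => complex.Re (f x))
   - charge_integral (cm_im zeta) (fun x => complex.Im (f x)))
  +i* (charge_integral (cm_re zeta) (fun x => complex.Im (f x))
       + charge_integral (cm_im zeta) (fun x => complex.Re (f x))).

End Complex_measures.
Arguments complex_measure {d} T R.

Section Conditional_expectation.
Context {d : measure_display} {Om : measurableType d} {R : realType}.
Variables (P : probability Om R) (G : set (set Om)).

Definition sub_measurable (Y : Om -> R) : Prop :=
  measurable_fun [set: g_sigma_algebraType G] (Y : g_sigma_algebraType G -> R).

(* Y is a version of E[X | G]. As usual, X need only be defined up to a P-null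
   set: for instance h(G_T, S_T) has a meaning on the event S_T > 0 only. In
   particular, a version exists only if X is integrable. *)
Definition is_cond_exp (X Y : Om -> R) : Prop :=
  [/\ sub_measurable Y,
      P.-integrable setT (EFin \o Y) &
      exists X' : Om -> R,
        [/\ P.-integrable setT (EFin \o X'),
            {ae P, forall w, X w = X' w} &
            forall A, G A ->
              (\int[P]_(w in A) (Y w)%:E = \int[P]_(w in A) (X' w)%:E)%E ] ].

Definition is_ccond_exp (X Y : Om -> R[i]) : Prop :=
  is_cond_exp (fun w => complex.Re (X w)) (fun w => complex.Re (Y w)) /\
  is_cond_exp (fun w => complex.Im (X w)) (fun w => complex.Im (Y w)).

End Conditional_expectation.

(* Processes and filtrations are indexed by R, but only their restriction to
   [0, T] matters. *)
Section Processes.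
Context {d : measure_display} {Om : measurableType d} {R : realType}.
Variables (P : probability Om R) (F : R -> set (set Om)) (T : R).
Implicit Types X M A : R -> Om -> R.

Definition is_filtration : Prop :=
  [/\ forall t : R, 0 <= t <= T -> sigma_algebra setT (F t),
      forall t : R, 0 <= t <= T -> F t `<=` measurable &
      forall s t : R, 0 <= s -> s <= t -> t <= T -> F s `<=` F t].

Definition adapted X : Prop := forall t : R, 0 <= t <= T -> sub_measurable (F t) (X t).

Definition martingale X : Prop :=
  [/\ adapted X,
      forall t : R, 0 <= t <= T -> P.-integrable setT (EFin \o X t) &
      forall s t : R, 0 <= s -> s <= t -> t <= T -> is_cond_exp P (F s) (X t) (X s)].

Definition continuous_paths X : Prop :=
  {ae P, forall w, {within `[0, T], continuous (fun t => X t w)}}.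

Definition cadlag_paths X : Prop :=
  {ae P, forall w,
    (forall t : R, 0 <= t < T -> X s w @[s --> t^'+] --> X t w) /\
    (forall t : R, 0 < t <= T -> exists l : R, X s w @[s --> t^'-] --> l)}.

Definition finite_variation_paths X : Prop :=
  {ae P, forall w, bounded_variation 0 T (fun t => X t w)}.

Definition stopping_time (tau : Om -> R) : Prop :=
  (forall w, 0 <= tau w <= T) /\
  (forall t : R, 0 <= t <= T -> F t [set w | tau w <= t]).

Definition localizing (tau : nat -> Om -> R) : Prop :=
  [/\ forall n, stopping_time (tau n),
      {ae P, forall w, forall n, tau n w <= tau n.+1 w} &
      {ae P, forall w, exists n, tau n w = T}].

Definition local_martingale M : Prop :=
  [/\ adapted M, cadlag_paths M &
      exists2 tau : nat -> Om -> R, localizing tau &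
        forall n, martingale (fun t w => M (Num.min t (tau n w)) w - M 0 w)].

Definition semimartingale X : Prop :=
  adapted X /\
  exists M A : R -> Om -> R,
    [/\ local_martingale M,
        [/\ adapted A, cadlag_paths A & finite_variation_paths A] &
        {ae P, forall w, forall t : R, 0 <= t <= T -> X t w = M t w + A t w}].

End Processes.

Section Geometric_average.
Context {d : measure_display} {Om : measurableType d} {R : realType}.
Variables (g : probability (measurableTypeR R) R) (S : R -> Om -> R).

Definition geo_avg (t : R) (w : Om) : R :=
  expR (\int[g]_(u in `[0, t]) ln (S u w)).

Definition geo_avg_tail (t T : R) (w : Om) : R :=
  expR (\int[g]_(u in `]t, T]) ln (S u w)).

End Geometric_average.

(* The arguments (s, w) of Psi_t that the pricing formula uses. *)
Definition psi_arg {R : realType} (rho : R) (s w : R[i]) : Prop :=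
  (s = 1 /\ w = 0) \/ (complex.Re s = rho /\ (w = 0 \/ w = 1 - s)).

Definition jointly_measurable {d : measure_display} {Om : measurableType d}
    {R : realType} (G : set (set Om)) (Y : R -> Om -> R[i]) : Prop :=
  measurable_fun [set: measurableTypeR R * g_sigma_algebraType G]
    (fun p => complex.Re (Y p.1 p.2)) /\
  measurable_fun [set: measurableTypeR R * g_sigma_algebraType G]
    (fun p => complex.Im (Y p.1 p.2)).

(* Psi is a version of (s, w) |-> E[Gt^s ST^w | Ft]. Conditional expectations
   are defined up to a null set depending on (s, w), so integrating over the
   line rho + iR needs a version that is jointly measurable along the line. *)
Definition psi_version {d : measure_display} {Om : measurableType d}
    {R : realType} (P : probability Om R) (Ft : set (set Om)) (rho : R)
    (Gt ST : Om -> R) (Psi : R[i] -> R[i] -> Om -> R[i]) : Prop :=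
  [/\ forall s w, psi_arg rho s w ->
        is_ccond_exp P Ft (fun omega => cpow (Gt omega) s * cpow (ST omega) w)
          (Psi s w),
      jointly_measurable Ft (fun v => Psi (rho +i* v) 0) &
      jointly_measurable Ft (fun v => Psi (rho +i* v) (1 - (rho +i* v)))].

(* Main.v *)
(* Condition h(G_T, S_T) = a + b G_T + c S_T + (two integrals over the line)
   term by term. As G_T = G_t G_{t,T} with G_t measurable with respect to F_t,
   E[G_T^z S_T^w | F_t] = G_t^z Psi_t(z, w), and E[S_T | F_t] = e^{r(T-t)} S_t.
   Fubini moves the conditional expectation under the integrals: on the line
   |G_T^z| = G_T^R <= 1 + G_T and |G_T^z S_T^{1-z}| = G_T^R S_T^{1-R} <= G_T + S_T
   uniformly in z, and conditioning contracts the L^1 norm, which also gives the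
   absolute convergence.
   The logarithm of a geometric average is a limit of Riemann sums. This makes
   G_t almost surely equal to an F_t-measurable function, and AM-GM for the sums
   followed by Fatou's lemma bounds E[G_T] and E[G_{t,T}] by the expectations
   of the S_u. *)
Require Import Defs.
From HB Require Import structures.
From mathcomp Require Import all_boot all_order all_algebra.
From mathcomp Require Import all_classical all_reals all_analysis.
From mathcomp Require Import complex.
From mathcomp Require Import measurable_realfun ring.

Set Implicit Arguments.
Unset Strict Implicit.
Unset Printing Implicit Defensive.

Import Order.TTheory GRing.Theory Num.Theory.
Import numFieldNormedType.Exports.

Local Open Scope classical_set_scope.
Local Open Scope ring_scope.
Local Open Scope complex_scope.

(** The obstacle is measurability. [Psi s w] is fixed only up to a null set for each pair, and
    uncountably many pairs occur on the line, so the existence of a version jointly measurable in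
    the parameter has to be proved. It rests on the form of the integrands: each is [d e^{ivl}] with
    a modulus [d] that is integrable and independent of [v]. Such a family is uniformly continuous
    in L^1 as a function of [v], conditioning preserves this, and versions chosen at countably many
    grid points determine all the others in the limit. The averages raise a second difficulty. Paths
    are continuous and positive only almost surely and the filtration is not assumed complete, so
    [G_t] need not be measurable. Everywhere defined logarithms of [G_t], [G_{t,T}] and [S_T]
    replace these variables up to null sets; their exponentials are positive at every outcome. The
    factor [G_t^z] is unbounded. It is taken out of the conditional expectation through measures: a
    version is a Radon-Nikodym density on the coarser sigma-algebra, and the change of variables
    formula treats all factors with an integrable product at once. *)

(** * Image measures and measures given by a density *)

Section Image_measures.
Context {d : measure_display} {T : measurableType d} {R : realType}.
Variable mu : {finite_measure set T -> \bar R}.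
Local Open Scope ereal_scope.

(** When [pi] is the identity onto a coarser structure, this is the restriction of [mu] to a
    sub-sigma-algebra, bundled as the finite measure to which Radon-Nikodym is applied. *)
Lemma image_finite_measure {d'} {U : measurableType d'} (pi : {mfun T >-> U}) :
  exists nu : {finite_measure set U -> \bar R},
    forall A, nu A = mu (pi @^-1` A).
Proof.
pose nu A := mu (pi @^-1` A).
have nu0 : nu set0 = 0 by rewrite /nu preimage_set0 measure0.
have nu_ge0 A : 0 <= nu A by exact: measure_ge0.
have nu_sigma : semi_sigma_additive nu.
  move=> F mF tF mUF; rewrite /nu preimage_bigcup.
  apply: measure_semi_sigma_additive.
  - by move=> n; exact: measurable_funPTI.
  - apply/trivIsetP => /= i j _ _ ij; rewrite -preimage_setI.
    by move/trivIsetP : tF => /(_ _ _ _ _ ij) ->//; rewrite preimage_set0.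
  - by rewrite -preimage_bigcup; exact: measurable_funPTI.
pose m := isMeasure.Build _ _ _ nu nu0 nu_ge0 nu_sigma.
have nufin : fin_num_fun nu.
  by move=> A mA; apply: fin_num_measure; exact: measurable_funPTI.
pose m0 : {measure set U -> \bar R} := HB.pack nu m.
pose f := Measure_isFinite.Build _ _ _ m0 nufin.
pose n0 : {finite_measure set U -> \bar R} := HB.pack nu m f.
by exists n0.
Qed.

Lemma density_finite_measure (X : T -> R) : (forall x, 0 <= X x)%R ->
  mu.-integrable setT (EFin \o X) ->
  exists nu : {finite_measure set T -> \bar R},
    forall A, nu A = \int[mu]_(x in A) (X x)%:E.
Proof.
move=> X0 iX.
have n0 : forall E, 0 <= induced_charge iX E.
  by move=> E; apply: integral_ge0 => x _; rewrite lee_fin.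
pose m : {measure set T -> \bar R} := measure_of_charge _ n0.
have mfin : fin_num_fun m.
  move=> A mA; rewrite /m /measure_of_charge.
  exact: (fin_num_measure (induced_charge iX)).
pose f := Measure_isFinite.Build _ _ _ m mfin.
pose n1 : {finite_measure set T -> \bar R} := HB.pack (Measure.sort m) f.
by exists n1.
Qed.

End Image_measures.

(** * Integration against a measure with density *)

Section Density.
Context {d : measure_display} {T : measurableType d} {R : realType}.
Variables mu nu : {finite_measure set T -> \bar R}.
Variable X : T -> R.
Hypothesis X_ge0 : forall x, 0 <= X x.
Hypothesis iX : mu.-integrable setT (EFin \o X).
Hypothesis nuE : forall A, nu A = (\int[mu]_(x in A) (X x)%:E)%E.
Local Open Scope ereal_scope.

Lemma density_dominates : nu `<< mu.
Proof.
apply/null_content_dominatesP => /= A mA muA.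
rewrite nuE; apply: null_set_integral => //.
by apply: measurable_funTS; exact: measurable_int iX.
Qed.

(** The Radon-Nikodym derivative of [nu] agrees with [X] almost everywhere, so the change of
    variables formula may be written with [X]. As [X] is nonnegative, the positive and negative
    parts of [K * X] are those of [K] times [X]. *)
Lemma density_integral (K : T -> R) A : measurable_fun setT K -> measurable A ->
  mu.-integrable setT (fun x => (K x * X x)%:E) ->
  \int[nu]_(x in A) (K x)%:E = \int[mu]_(x in A) (K x * X x)%:E.
Proof.
move=> mK mA iKX.
have mX : measurable_fun setT X by apply/measurable_EFinP; exact: measurable_int iX.
have dom := density_dominates.
pose f := Radon_Nikodym_SigmaFinite.f nu mu.
have fi : mu.-integrable setT f by exact: Radon_Nikodym_SigmaFinite.f_integrable.
have fX : ae_eq mu setT f (EFin \o X).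
  apply: integral_ae_eq => //; first exact: measurable_int iX.
  by move=> E _ mE; rewrite -Radon_Nikodym_SigmaFinite.f_integral// nuE.
have change (L : T -> \bar R) : (forall x, 0 <= L x) -> measurable_fun setT L ->
    \int[nu]_(x in A) L x = \int[mu]_(x in A) (L x * (X x)%:E).
  move=> L0 mL; rewrite -(Radon_Nikodym_SigmaFinite.change_of_variables dom)//; last first.
    exact: measurable_funTS.
  apply: ae_eq_integral => //.
  - by apply: measurable_funTS; apply: emeasurable_funM => //; exact: measurable_int fi.
  - apply: measurable_funTS; apply: emeasurable_funM => //.
    exact/measurable_EFinP.
  - by move: fX; apply: filterS => x /= /(_ I) + _ => <-.
have mKe : measurable_fun setT (EFin \o K) by exact/measurable_EFinP.
rewrite integralE [RHS]integralE !change//.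
- congr (_ - _); apply: eq_integral => x _.
  + by rewrite !funeposE/= EFinM maxeMl ?lee_fin// mul0e.
  + by rewrite !funenegE/= -mulNr EFinM maxeMl ?lee_fin// mul0e.
- exact: measurable_funeneg.
- exact: measurable_funepos.
Qed.

End Density.

(** * Calculus of real conditional expectations *)

(* Conditional expectations are written with respect to a measurable map [pi]:
   [Y \o pi] is a version of [E[X | pi]]. A sub-sigma-algebra is the case where
   [pi] is the identity, with a coarser structure on its codomain. *)
Section Conditional_expectation_along_a_map.
Context {d d' : measure_display} {Om : measurableType d} {Om' : measurableType d'}.
Context {R : realType}.
Variables (P : probability Om R) (pi : {mfun Om >-> Om'}).
Implicit Types (X : Om -> R) (Y K : Om' -> R).
Local Open Scope ereal_scope.

(** Here [X] itself is integrable, hence measurable. The freedom to change [X] on a null set,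
    present in [is_cond_exp], is restored in [is_cond_expP]. *)
Definition cond_version X Y : Prop :=
  [/\ measurable_fun setT Y, P.-integrable setT (EFin \o X),
      P.-integrable setT (EFin \o Y \o pi) &
      forall A, measurable A ->
        \int[P]_(w in pi @^-1` A) (Y (pi w))%:E
        = \int[P]_(w in pi @^-1` A) (X w)%:E].

Lemma ae_distribution (Q : Om' -> Prop) :
  {ae distribution P pi, forall x, Q x} -> {ae P, forall w, Q (pi w)}.
Proof.
move=> [N [mN N0 QN]]; exists (pi @^-1` N); split => //.
- exact: measurable_funPTI.
- by move=> w /= /QN.
Qed.

Lemma integrable_distribution Y : measurable_fun setT Y ->
  P.-integrable setT (EFin \o Y \o pi) ->
  (distribution P pi).-integrable setT (EFin \o Y).
Proof.
move=> mY iY; apply: integrable_pushforward => //.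
exact/measurable_EFinP.
Qed.

Lemma integral_distribution Y A : measurable_fun setT Y -> measurable A ->
  P.-integrable setT (EFin \o Y \o pi) ->
  \int[distribution P pi]_(x in A) (Y x)%:E = \int[P]_(w in pi @^-1` A) (Y (pi w))%:E.
Proof.
move=> mY mA iY; rewrite (@integral_pushforward _ _ _ _ _ pi) //.
- exact/measurable_EFinP.
- by apply: integrableS iY => //; exact: measurable_funPTI.
Qed.

Lemma cond_version_unique X Y1 Y2 : cond_version X Y1 -> cond_version X Y2 ->
  {ae P, forall w, Y1 (pi w) = Y2 (pi w)}.
Proof.
move=> [mY1 iX iY1 Y1E] [mY2 _ iY2 Y2E].
apply: (@ae_distribution (fun x => Y1 x = Y2 x)).
suff : ae_eq (distribution P pi) setT (EFin \o Y1) (EFin \o Y2).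
  by apply: filterS => x /= /(_ I) [].
apply: integral_ae_eq => //.
- exact: integrable_distribution.
- exact/measurable_EFinP.
- by move=> A _ mA; rewrite !integral_distribution// Y1E// Y2E.
Qed.

Lemma cond_versionZ (k : R) X Y : cond_version X Y ->
  cond_version (fun w => k * X w)%R (fun x => k * Y x)%R.
Proof.
move=> [mY iX iY YE]; split.
- exact: measurable_funM.
- exact: (integrableZl measurableT k iX).
- exact: (integrableZl measurableT k iY).
- move=> A mA; have mpA := measurable_funPTI pi mA.
  under eq_integral do rewrite EFinM.
  under [RHS]eq_integral do rewrite EFinM.
  rewrite !integralZl ?YE//; [exact: integrableS iX|exact: integrableS iY].
Qed.

Lemma cond_versionD X1 X2 Y1 Y2 : cond_version X1 Y1 -> cond_version X2 Y2 ->
  cond_version (fun w => X1 w + X2 w)%R (fun x => Y1 x + Y2 x)%R.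
Proof.
move=> [mY1 iX1 iY1 Y1E] [mY2 iX2 iY2 Y2E]; split.
- exact: measurable_funD.
- exact: (integrableD measurableT iX1 iX2).
- exact: (integrableD measurableT iY1 iY2).
- move=> A mA; have mpA := measurable_funPTI pi mA.
  under eq_integral do rewrite EFinD.
  under [RHS]eq_integral do rewrite EFinD.
  by rewrite !integralD ?Y1E ?Y2E//;
    [exact: integrableS iX1|exact: integrableS iX2|
     exact: integrableS iY1|exact: integrableS iY2].
Qed.

Lemma cond_versionB X1 X2 Y1 Y2 : cond_version X1 Y1 -> cond_version X2 Y2 ->
  cond_version (fun w => X1 w - X2 w)%R (fun x => Y1 x - Y2 x)%R.
Proof.
move=> XY1 XY2; have := cond_versionD XY1 (cond_versionZ (-1) XY2).
congr cond_version; apply/funext => x; by rewrite mulN1r.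
Qed.

Lemma cond_version_cst (k : R) : cond_version (cst k) (cst k).
Proof.
by split => //; exact: finite_measure_integrable_cst.
Qed.

(* [Y] is the density of the image under [pi] of the measure [X * P]. *)
Let pull_out_ge0 X : (forall w, 0 <= X w)%R -> P.-integrable setT (EFin \o X) ->
  exists2 Y, measurable_fun setT Y & forall K, measurable_fun setT K ->
    P.-integrable setT (fun w => (K (pi w) * X w)%:E) ->
    cond_version (fun w => K (pi w) * X w)%R (fun x => K x * Y x)%R.
Proof.
move=> X0 iX.
have mX : measurable_fun setT X by apply/measurable_EFinP; exact: measurable_int iX.
have [nu nuE] := density_finite_measure X0 iX.
have [nu' nu'E] := image_finite_measure nu pi.
pose mu' : {finite_measure set Om' -> \bar R} := distribution P pi.
have dom := density_dominates iX nuE.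
have dom' : nu' `<< mu'.
  apply/null_content_dominatesP => A mA A0.
  rewrite nu'E.
  by move/null_content_dominatesP : dom; apply => //; exact: measurable_funPTI.
pose f := Radon_Nikodym_SigmaFinite.f nu' mu'.
have f0 x : 0 <= f x by exact: Radon_Nikodym_SigmaFinite.f_ge0.
have ffin x : f x \is a fin_num by exact: Radon_Nikodym_SigmaFinite.f_fin_num.
have fi : mu'.-integrable setT f by exact: Radon_Nikodym_SigmaFinite.f_integrable.
have mf : measurable_fun setT f by exact: measurable_int fi.
have mY : measurable_fun setT (fine \o f) by exact: measurableT_comp.
exists (fine \o f) => // K mK iKX.
have mKe : measurable_fun setT (EFin \o K) by exact/measurable_EFinP.
have mKY : measurable_fun setT (fun x => K x * fine (f x))%R by exact: measurable_funM.
(* Both sides equal the integral of [L] over [A] against [nu']: the left one because [f] is its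
   density with respect to the law of [pi], the right one because [X] is the density of [nu]. *)
have change (L : Om' -> R) A : (forall x, 0 <= L x)%R -> measurable_fun setT L ->
    measurable A ->
    P.-integrable setT (fun w => (L (pi w) * X w)%:E) ->
    \int[P]_(w in pi @^-1` A) (L (pi w) * fine (f (pi w)))%:E
    = \int[P]_(w in pi @^-1` A) (L (pi w) * X w)%:E.
  move=> L0 mL mA iLX.
  have mLe : measurable_fun setT (EFin \o L) by exact/measurable_EFinP.
  have mLf : measurable_fun setT (fun x => (L x)%:E * f x) by exact: emeasurable_funM.
  rewrite -(density_integral X0 iX nuE)//; [|exact: measurableT_comp|exact: measurable_funPTI].
  under eq_integral do rewrite EFinM fineK//.
  rewrite -(ge0_integral_pushforward (phi:=pi) _ _ (f := fun x => (L x)%:E * f x))//; last first.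
  - by move=> y _; rewrite mule_ge0// lee_fin.
  - exact: measurable_funTS.
  have Le0 x : 0 <= (EFin \o L) x by rewrite lee_fin.
  have -> := Radon_Nikodym_SigmaFinite.change_of_variables dom' Le0 mA (measurable_funTS mLe).
  rewrite -(ge0_integral_pushforward (phi:=pi) _ _ (f := EFin \o L))//.
    by apply: eq_measure_integral => B mB BA; exact: nu'E.
  exact: measurable_funTS.
(* Since [f] and [X] are nonnegative, [change] for [|K|] on the whole space says that [K f] and
   [K X] have the same L^1 norm. *)
have iKY : P.-integrable setT (fun w => (K (pi w) * fine (f (pi w)))%:E).
  apply/integrableP; split.
    apply/measurable_EFinP.
    exact: (measurableT_comp mKY).
  have mnK : measurable_fun setT (fun x => `|K x|)%R by exact: measurableT_comp.
  have iKXn : P.-integrable setT (fun w => (`|K (pi w)| * X w)%:E).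
    apply: le_integrable iKX => //.
      apply/measurable_EFinP/measurable_funM => //.
      exact: (measurableT_comp mnK).
    by move=> w _ /=; rewrite lee_fin normrM (normrM (K _)) normr_id.
  have := change (fun x => `|K x|)%R setT (fun x => normr_ge0 _) mnK measurableT iKXn.
  rewrite preimage_setT => E.
  under eq_integral.
    move=> w _ /=; rewrite normrM (ger0_norm (fine_ge0 (f0 _))); over.
  rewrite E.
  by have := integrable_lty measurableT iKXn.
split => // A mA.
have mpA := measurable_funPTI pi mA.
pose Kp := K^\+%R; pose Kn := K^\-%R.
have Kpn x : K x = (Kp x - Kn x)%R by rewrite -[in LHS](funrposBneg K).
have mKp : measurable_fun setT Kp by exact: measurable_funrpos.
have mKn : measurable_fun setT Kn by exact: measurable_funrneg.
have Kp0 x : (0 <= Kp x)%R by exact: funrpos_ge0.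
have Kn0 x : (0 <= Kn x)%R by exact: funrneg_ge0.
have KpK x : (Kp x <= `|K x|)%R by rewrite /Kp /funrpos ge_max ler_norm normr_ge0.
have KnK x : (Kn x <= `|K x|)%R by rewrite /Kn /funrneg ge_max -normrN ler_norm normr_ge0.
have dom_int (L : Om' -> R) (Z : Om -> R) : measurable_fun setT L ->
   measurable_fun setT Z -> (forall w, 0 <= L w)%R ->
   (forall w, L w <= `|K w|)%R ->
   P.-integrable setT (fun w => (K (pi w) * Z w)%:E) ->
   P.-integrable setT (fun w => (L (pi w) * Z w)%:E).
  move=> mL mZ L0 LK; apply: le_integrable => //.
    apply/measurable_EFinP/measurable_funM => //.
    exact: (measurableT_comp mL).
  by move=> w _ /=; rewrite lee_fin !normrM ler_wpM2r// ger0_norm.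
have mfpi : measurable_fun setT (fun w => fine (f (pi w))).
  exact: (measurableT_comp mY).
have split_int (Z : Om -> R) : measurable_fun setT Z ->
   P.-integrable setT (fun w => (K (pi w) * Z w)%:E) ->
   \int[P]_(w in pi @^-1` A) (K (pi w) * Z w)%:E =
   \int[P]_(w in pi @^-1` A) (Kp (pi w) * Z w)%:E -
   \int[P]_(w in pi @^-1` A) (Kn (pi w) * Z w)%:E.
  move=> mZ iKZ; rewrite -integralB//.
  - by apply: eq_integral => w _; rewrite Kpn mulrBl EFinB.
  - by apply: integrableS (dom_int _ _ mKp mZ Kp0 KpK iKZ).
  - by apply: integrableS (dom_int _ _ mKn mZ Kn0 KnK iKZ).
rewrite !split_int// !change//.
- exact: dom_int iKX.
- exact: dom_int iKX.
Qed.

(** [Y] is chosen before [K], so one version serves all factors, bounded or not. The case [K = 1]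
    shows that it is a version of the conditional expectation of [X]. *)
Lemma cond_version_ex_pull_out X : P.-integrable setT (EFin \o X) ->
  exists2 Y, measurable_fun setT Y & forall K, measurable_fun setT K ->
    P.-integrable setT (fun w => (K (pi w) * X w)%:E) ->
    cond_version (fun w => K (pi w) * X w)%R (fun x => K x * Y x)%R.
Proof.
move=> iX.
have mX : measurable_fun setT X by apply/measurable_EFinP; exact: measurable_int iX.
have iXp := integrable_funrpos measurableT iX.
have iXn := integrable_funrneg measurableT iX.
have [Yp mYp YpE] := pull_out_ge0 (@funrpos_ge0 _ _ X) iXp.
have [Yn mYn YnE] := pull_out_ge0 (@funrneg_ge0 _ _ X) iXn.
exists (fun x => Yp x - Yn x)%R; first exact: measurable_funB.
move=> K mK iKX.
have mKpi : measurable_fun setT (fun w => K (pi w)) by exact: (measurableT_comp mK).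
have XE w : (X^\+ w - X^\- w = X w)%R by rewrite -[in RHS](funrposBneg X).
have -> : (fun w => K (pi w) * X w)%R =
    (fun w => K (pi w) * X^\+ w - K (pi w) * X^\- w)%R.
  by apply/funext => w; rewrite -mulrBr XE.
have -> : (fun x => K x * (Yp x - Yn x))%R = (fun x => K x * Yp x - K x * Yn x)%R.
  by apply/funext => x; rewrite mulrBr.
apply: cond_versionB; [apply: YpE => //|apply: YnE => //].
  apply: le_integrable iKX => //.
    by apply/measurable_EFinP/measurable_funM => //; exact: measurable_funrpos.
  move=> w _ /=; rewrite lee_fin !normrM ler_wpM2l//.
  by rewrite ger0_norm ?funrpos_ge0// /funrpos ge_max ler_norm normr_ge0.
apply: le_integrable iKX => //.
  by apply/measurable_EFinP/measurable_funM => //; exact: measurable_funrneg.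
move=> w _ /=; rewrite lee_fin !normrM ler_wpM2l//.
by rewrite ger0_norm ?funrneg_ge0// /funrneg ge_max -normrN ler_norm normr_ge0.
Qed.

Lemma cond_version_ex X : P.-integrable setT (EFin \o X) ->
  exists Y, cond_version X Y.
Proof.
move=> iX; have [Y mY YE] := cond_version_ex_pull_out iX.
exists Y; have := YE (cst 1%R) (measurable_cst _).
rewrite (_ : (fun w => _ * X w)%R = X); last by apply/funext => w; rewrite mul1r.
rewrite (_ : (fun x => _ * Y x)%R = Y); last by apply/funext => x; rewrite mul1r.
by apply; under eq_fun do rewrite mul1r.
Qed.

Lemma cond_version_ae X Y Y' : measurable_fun setT Y' ->
  {ae P, forall w, Y (pi w) = Y' (pi w)} ->
  cond_version X Y -> cond_version X Y'.
Proof.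
move=> mY' YY' [mY iX iY YE].
have mYpi := measurableT_comp mY (measurable_funPT pi).
have mYpi' := measurableT_comp mY' (measurable_funPT pi).
have ae A : ae_eq P A (EFin \o Y \o pi) (EFin \o Y' \o pi).
  by move: YY'; apply: filterS => w /= ->.
split => //.
  apply/integrableP; split; first exact/measurable_EFinP.
  have -> : \int[P]_w `|(EFin \o Y' \o pi) w| = \int[P]_w `|(EFin \o Y \o pi) w|.
    apply: ae_eq_integral => //.
    - by apply/measurableT_comp => //; exact/measurable_EFinP.
    - by apply/measurableT_comp => //; exact/measurable_EFinP.
    - exact/ae_eq_sym/ae_eq_abse/ae.
  by case/integrableP : iY.
move=> A mA; rewrite -YE//; apply: ae_eq_integral.
- exact: measurable_funPTI.
- by apply: measurable_funTS; exact/measurable_EFinP.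
- by apply: measurable_funTS; exact/measurable_EFinP.
- exact/ae_eq_sym/ae.
Qed.

(** The rule holds for the version [Z] built as a density, and any other version equals [Z] almost
    surely. *)
Lemma cond_version_pull_out K X Y : measurable_fun setT K ->
  P.-integrable setT (fun w => (K (pi w) * X w)%:E) ->
  cond_version X Y ->
  cond_version (fun w => K (pi w) * X w)%R (fun x => K x * Y x)%R.
Proof.
move=> mK iKX YE; have [mY iX _ _] := YE.
have [Z mZ ZE] := cond_version_ex_pull_out iX.
apply: cond_version_ae (ZE K mK iKX); first exact: measurable_funM.
have ZX : cond_version X Z.
  have := ZE (cst 1%R) (measurable_cst _).
  rewrite (_ : (fun w => _ * X w)%R = X); last by apply/funext => w; rewrite mul1r.
  rewrite (_ : (fun x => _ * Z x)%R = Z); last by apply/funext => x; rewrite mul1r.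
  by apply; under eq_fun do rewrite mul1r.
by move: (cond_version_unique ZX YE); apply: filterS => w ->.
Qed.

Lemma cond_version_contraction X Y : cond_version X Y ->
  \int[P]_w `|(Y (pi w))%:E| <= \int[P]_w `|(X w)%:E|.
Proof.
move=> [mY iX iY YE].
pose A := [set x | (0 <= Y x)%R].
have mA : measurable A.
  have := emeasurable_fun_c_infty measurableT (f := EFin \o Y) _ 0.
  by rewrite setTI; apply; exact/measurable_EFinP.
have mpA := measurable_funPTI pi mA.
have mpCA := measurable_funPTI pi (measurableC mA).
have mYpi := measurableT_comp mY (measurable_funPT pi).
have mX : measurable_fun setT X by apply/measurable_EFinP; exact: measurable_int iX.
have mX' : measurable_fun setT (fun w => `|(X w)%:E|).
  by apply: measurableT_comp => //; exact/measurable_EFinP.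
have mY' : measurable_fun setT (fun w => `|(Y (pi w))%:E|).
  by apply: measurableT_comp => //; exact/measurable_EFinP.
have TE : [set: Om] = (pi @^-1` A) `|` (pi @^-1` ~` A).
  by rewrite -preimage_setU setUv preimage_setT.
have dis : [disjoint pi @^-1` A & pi @^-1` ~` A].
  by apply/disj_setPS => w [].
rewrite TE !ge0_integral_setU//; [|exact: measurable_funTS..].
apply: leeD.
  rewrite (eq_integral (fun w => (Y (pi w))%:E)).
    rewrite YE//; apply: le_trans (lee_abs _) _.
    apply: le_abse_integral => //.
    by apply: measurable_funTS; exact/measurable_EFinP.
  by move=> w; rewrite inE /= => Yw; rewrite ger0_norm.
rewrite (eq_integral (fun w => - (Y (pi w))%:E)).
  rewrite integralN ?(YE _ (measurableC mA))//; last first.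
    apply: integrable_add_def => //; exact: integrableS iY.
    apply: le_trans (lee_abs _) _; rewrite abseN.
  apply: le_abse_integral => //.
  by apply: measurable_funTS; exact/measurable_EFinP.
by move=> w; rewrite inE /= => /negP; rewrite -ltNge => Yw; rewrite ltr0_norm.
Qed.

End Conditional_expectation_along_a_map.

(** * Fubini for real-valued integrals *)

Section Fubini_for_Rintegral.
Context {d1 d : measure_display} {V : measurableType d1}.
Context {Om : measurableType d} {R : realType}.
Local Open Scope ereal_scope.

(** Integrability of the sections is not assumed: Tonelli applies to the positive and negative
    parts, and [fine] turns infinite values into 0 measurably. *)
Lemma measurable_fun_Rintegral (mu : {finite_measure set V -> \bar R})
    (f : V * Om -> R) : measurable_fun setT f ->
  measurable_fun setT (fun w => (\int[mu]_v f (v, w))%R).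
Proof.
move=> mf.
have mfe : measurable_fun setT (EFin \o f) by exact/measurable_EFinP.
apply: (measurableT_comp (f := fine)) => //.
rewrite (_ : (fun w => _) = (fun w => \int[mu]_v (EFin \o f)^\+ (v, w)) \-
    (fun w => \int[mu]_v (EFin \o f)^\- (v, w))); last first.
  apply/funext => w; rewrite [LHS]integralE.
  by congr (_ - _); apply: eq_integral => v _; rewrite !(funeposE,funenegE).
apply: emeasurable_funB.
- apply: (@measurable_fun_fubini_tonelli_G _ _ _ _ _ mu (EFin \o f)^\+) => //.
  exact: measurable_funepos.
- apply: (@measurable_fun_fubini_tonelli_G _ _ _ _ _ mu (EFin \o f)^\-) => //.
  exact: measurable_funeneg.
Qed.

Lemma ae_integrable_section (mu : {finite_measure set V -> \bar R})
    (P : probability Om R) (f : V * Om -> R) :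
  (mu \x P).-integrable setT (EFin \o f) ->
  {ae P, forall w, mu.-integrable setT (fun v => (f (v, w))%:E)}.
Proof. exact: ae_integrable2. Qed.

Lemma integrable_Rintegral (mu : {finite_measure set V -> \bar R})
    (P : probability Om R) (f : V * Om -> R) :
  (mu \x P).-integrable setT (EFin \o f) ->
  P.-integrable setT (fun w => (\int[mu]_v f (v, w))%R%:E).
Proof.
move=> fi; have mf : measurable_fun setT f.
  by apply/measurable_EFinP; exact: measurable_int fi.
have mfe : measurable_fun setT (fun p => `|(f p)%:E|).
  by apply: measurableT_comp => //; exact/measurable_EFinP.
have mRf := measurable_fun_Rintegral mu mf.
apply/integrableP; split; first exact/measurable_EFinP.
apply: le_lt_trans ((integrable21ltyP _ _ (measurable_int _ fi)).1 fi).
apply: ge0_le_integral => //.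
- by apply: measurableT_comp => //; exact/measurable_EFinP.
- exact: (@measurable_fun_fubini_tonelli_G _ _ _ _ _ mu (fun p => `|(f p)%:E|)).
- move=> w _; apply: (@le_trans _ _ `|\int[mu]_v (f (v, w))%:E|).
    by rewrite /Rintegral; case: (\int[mu]_v _) => //=; rewrite ?normr0 ?leey.
  apply: le_abse_integral => //; apply/measurable_EFinP.
  exact: (measurableT_comp mf (pair2_measurable w)).
Qed.

(** Cutting [f] off outside the cylinder [B] over [A] moves the restriction into the integrand, so
    Fubini can be applied on the whole product. Almost every section is integrable, so [fine] alters
    nothing outside a null set. *)
Lemma Fubini_Rintegral (mu : {finite_measure set V -> \bar R})
    (P : probability Om R) (f : V * Om -> R) A : measurable A ->
  (mu \x P).-integrable setT (EFin \o f) ->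
  \int[P]_(w in A) (\int[mu]_v f (v, w))%R%:E =
  \int[mu]_v \int[P]_(w in A) (f (v, w))%:E.
Proof.
move=> mA fi.
have mf : measurable_fun setT f.
  by apply/measurable_EFinP; exact: measurable_int fi.
pose B : set (V * Om) := snd @^-1` A.
have mB : measurable B by rewrite -[B]setTI; exact: measurable_snd.
have fBi : (mu \x P).-integrable setT ((EFin \o f) \_ B).
  by apply: (integrable_mkcond _ mB).1; exact: integrableS fi.
transitivity (\int[P]_(w in A) \int[mu]_v (f (v, w))%:E).
  apply: ae_eq_integral => //.
  - apply: measurable_funTS; apply/measurable_EFinP.
    exact: measurable_fun_Rintegral.
  - by apply: measurable_funTS; exact: measurable_fubini_G fi.
  - move: (ae_integrable_section fi); apply: filterS => w fw _ /=.
    by rewrite /Rintegral fineK//; exact: integrable_fin_num.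
rewrite integral_mkcond.
have -> : (fun w => \int[mu]_v (f (v, w))%:E) \_ A =
    (fun w => \int[mu]_v ((EFin \o f) \_ B) (v, w)).
  apply/funext => w; rewrite patchE; case: ifPn => wA.
    by apply: eq_integral => v _; rewrite patchE mem_set//; exact: set_mem.
  rewrite integral0_eq// => v _; rewrite patchE memNset//.
  by move=> Bw; move/negP : wA; apply; exact: mem_set.
rewrite -(Fubini fBi); apply: eq_integral => v _.
rewrite [RHS]integral_mkcond; apply: eq_integral => w _.
by rewrite !patchE; congr (if _ then _ else _); apply/idP/idP => /set_mem H; exact: mem_set.
Qed.

End Fubini_for_Rintegral.

(** * Conditional expectation under an integral over a parameter *)

Section Conditional_Fubini.
Context {d1 d d' : measure_display} {V : measurableType d1}.
Context {Om : measurableType d} {Om' : measurableType d'} {R : realType}.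
Local Open Scope ereal_scope.
Variables (P : probability Om R) (pi : {mfun Om >-> Om'}).
Variables (X : V -> Om -> R) (Y : V -> Om' -> R) (C : R).
Hypothesis mX : measurable_fun setT (fun p : V * Om => X p.1 p.2).
Hypothesis mY : measurable_fun setT (fun p : V * Om' => Y p.1 p.2).
Hypothesis XY : forall v, cond_version P pi (X v) (Y v).
Hypothesis XC : forall v, \int[P]_w `|(X v w)%:E| <= C%:E.

Lemma cond_version_Rintegral (mu : {finite_measure set V -> \bar R}) :
  {ae P, forall w, mu.-integrable setT (fun v => (Y v (pi w))%:E)} /\
  cond_version P pi (fun w => \int[mu]_v X v w)%R (fun x => \int[mu]_v Y v x)%R.
Proof.
have bounded_integrable (Z : V -> Om -> R) :
    measurable_fun setT (fun p : V * Om => Z p.1 p.2) ->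
    (forall v, \int[P]_w `|(Z v w)%:E| <= C%:E) ->
    (mu \x P).-integrable setT (EFin \o (fun p : V * Om => Z p.1 p.2)).
  move=> mZ ZC; apply/integrable12ltyP; first exact/measurable_EFinP.
  apply: (@le_lt_trans _ _ (\int[mu]_v C%:E)).
    apply: ge0_le_integral => //.
    - by move=> v _; exact: integral_ge0.
    - apply: (@measurable_fun_fubini_tonelli_F _ _ _ _ _ P
        (fun p : V * Om => `|(Z p.1 p.2)%:E|)) => //.
      by apply: measurableT_comp => //; exact/measurable_EFinP.
    - by move=> v _; exact: ZC.
  (* [C] is nonnegative because it bounds an L^1 norm at one parameter, here [point]. *)
  by rewrite integral_cst// lte_mul_pinfty// ?fin_num_fun_lty//
    ?(le_trans _ (ZC point))// ?integral_ge0//; exact: finite_measure_fin_num_fun.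
have mYpi : measurable_fun setT (fun p : V * Om => Y p.1 (pi p.2)).
  apply: (measurableT_comp (f := fun p : V * Om' => Y p.1 p.2)
    (g := fun p : V * Om => (p.1, pi p.2))) => //.
  by apply: measurable_fun_pair => //; exact: measurableT_comp.
have iX := bounded_integrable X mX XC.
have iY : (mu \x P).-integrable setT (EFin \o (fun p : V * Om => Y p.1 (pi p.2))).
  apply: (bounded_integrable (fun v w => Y v (pi w))) => // v.
  exact: le_trans (cond_version_contraction (XY v)) (XC v).
split; first exact: ae_integrable_section iY.
split.
- exact: (measurable_fun_Rintegral mu mY).
- exact: integrable_Rintegral iX.
- exact: integrable_Rintegral iY.
- move=> A mA; have mpA := measurable_funPTI pi mA.
  rewrite (Fubini_Rintegral mpA iY) (Fubini_Rintegral mpA iX).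
  by apply: eq_integral => v _; case: (XY v) => _ _ _ ->.
Qed.

Lemma cond_version_charge_integral (nu : {charge set V -> \bar R}) :
  {ae P, forall w, charge_integrable nu (fun v => Y v (pi w))} /\
  cond_version P pi (fun w => charge_integral nu (X^~ w))
    (fun x => charge_integral nu (Y^~ x)).
Proof.
have [ip XYp] := cond_version_Rintegral (jordan_pos (charge_hahn nu)).
have [in_ XYn] := cond_version_Rintegral (jordan_neg (charge_hahn nu)).
split; last exact: cond_versionB XYp XYn.
apply: filterS2 ip in_ => w /integrableP[mw ip] /integrableP[_ in_].
apply/integrableP; split=> //.
(* The total variation is the sum of the two Jordan measures, so integrability reduces to the two
   finite integrals already obtained. *)
have -> : \int[charge_variation (charge_hahn nu)]_v `|(EFin \o (fun v => Y v (pi w))) v| =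
  \int[measure_add (jordan_pos (charge_hahn nu)) (jordan_neg (charge_hahn nu))]_v
    `|(EFin \o (fun v => Y v (pi w))) v|.
  apply: eq_measure_integral => A mA _.
  by rewrite /measure_add/= /msum 2!big_ord_recl big_ord0 /= adde0.
rewrite ge0_integral_measure_add//; last exact: measurableT_comp.
by rewrite lte_add_pinfty.
Qed.

End Conditional_Fubini.

(** * Measurable limits and almost sure convergence *)

Section Limits_of_measurable_functions.
Context {d : measure_display} {T : measurableType d} {R : realType}.

(** The upper limit is measurable on the whole space and equals the limit at each point of
    convergence, so the set of convergence never has to be examined. *)
Lemma measurable_limit (f : nat -> T -> R) :
  (forall n, measurable_fun setT (f n)) ->
  exists2 g : T -> R, measurable_fun setT g &
    forall x l, f n x @[n --> \oo] --> l -> g x = l.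
Proof.
move=> mf; exists (fun x => fine (limn_esup (fun n => (f n x)%:E))) => [|x l fl].
  apply: measurableT_comp => //.
  by apply: measurable_fun_limn_esup => n; exact/measurable_EFinP.
have /cvg_limn_einf_sup[_ ->//] : (f n x)%:E @[n --> \oo] --> l%:E.
by apply: cvg_EFin => //; exact: nearW.
Qed.

(** The bounds add up to 1, so the series of the [|f n - l|] has a finite integral. It is therefore
    finite almost everywhere, and its terms tend to 0 there. *)
Lemma ae_cvg_of_summable (mu : {measure set T -> \bar R}) (f : nat -> T -> R) (l : T -> R) :
  (forall n, measurable_fun setT (f n)) -> measurable_fun setT l ->
  (forall n, \int[mu]_x `|(f n x - l x)%:E| <= (1 / (2 ^ n.+1)%:R)%:E)%E ->
  {ae mu, forall x, f n x @[n --> \oo] --> l x}.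
Proof.
move=> mf ml fl.
pose u n x := `|(f n x - l x)%:E|%E.
have u_ge0 n x : (0 <= u n x)%E by exact: abse_ge0.
have mu_ n : measurable_fun setT (u n).
  by apply: measurableT_comp => //; apply/measurable_EFinP/measurable_funB.
have int_lty : (\int[mu]_x (\sum_(0 <= n <oo) u n x) < +oo)%E.
  rewrite integral_nneseries//.
  apply: (@le_lt_trans _ _ 1%:E); last exact: ltry 1.
  apply: le_trans (epsilon_trick0 xpredT ler01).
  apply: lee_nneseries.
    by move=> n _ _; apply: integral_ge0 => x _; exact: u_ge0.
  by move=> n _; exact: fl.
have mS : measurable_fun setT (fun x => \sum_(0 <= n <oo) u n x)%E.
  exact: ge0_emeasurable_sum.
have iS : mu.-integrable setT (fun x => \sum_(0 <= n <oo) u n x)%E.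
  apply/integrableP; split => //.
  rewrite (eq_integral (fun x => \sum_(0 <= n <oo) u n x)%E)// => x _.
  by rewrite gee0_abs// nneseries_ge0.
move: (integrable_ae measurableT iS); apply: filterS => x /(_ I) Sfin.
have S_lty : (\sum_(0 <= n <oo) u n x < +oo)%E by move: Sfin; rewrite fin_numElt => /andP[].
have tail : (\sum_(N <= n <oo) u n x)%E @[N --> \oo] --> 0%E.
  exact: nneseries_tail_cvg.
have u0 : u n x @[n --> \oo] --> 0%E.
  apply: (squeeze_cvge _ (cvg_cst 0%E) tail).
  apply: nearW => n; rewrite abse_ge0 /=.
  apply: le_trans (nneseries_lim_ge n.+1 _) => //.
  by rewrite big_nat1.
apply/cvgrPdist_lt => e e0.
have /fine_cvgP[_] : u n x @[n --> \oo] --> 0%:E by [].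
move=> /cvgrPdist_lt/(_ e e0); apply: filterS => n /=.
by rewrite sub0r normrN normr_id distrC.
Qed.

End Limits_of_measurable_functions.

(** * Versions jointly measurable in the parameter *)

Section Jointly_measurable_versions.
Context {d d' : measure_display} {Om : measurableType d} {Om' : measurableType d'}.
Context {R : realType}.
Variables (P : probability Om R) (pi : {mfun Om >-> Om'}).

(** The function does not depend on [v] within a strip where the integer part of [c * v] is [k], so
    a preimage is a countable union of rectangles. *)
Lemma measurable_floor_grid (Z : int -> Om' -> R) (c : R) :
  (forall k, measurable_fun setT (Z k)) ->
  measurable_fun setT
    (fun p : measurableTypeR R * Om' => Z (Num.floor (c * p.1)) p.2).
Proof.
move=> mZ _ B mB; rewrite setTI.
rewrite [X in measurable X](_ : _ = \bigcup_(k in [set: int])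
  ([set v : measurableTypeR R | k%:~R <= c * v < (k + 1)%:~R] `*` (Z k @^-1` B))); last first.
  apply/seteqP; split=> [[v x] /= Bvx|[v x] [k _ [/= kv Bx]]].
    by exists (Num.floor (c * v)) => //; split => //=; exact: floor_itv.
  by rewrite (floor_def kv).
apply: countable_bigcupT_measurable => // k.
apply: measurableX; last by rewrite -[X in measurable X]setTI; exact: mZ.
have mc : measurable_fun setT (fun v : measurableTypeR R => c * v).
  exact: mulrl_measurable.
rewrite (_ : [set v | _] =
  (fun v : measurableTypeR R => c * v) @^-1` `[k%:~R, (k + 1)%:~R[); last first.
  by apply/seteqP; split => v /=; rewrite in_itv.
by rewrite -[X in measurable X]setTI; exact: mc.
Qed.

Lemma floor_grid_dist (c v : R) : 0 < c ->
  `|(Num.floor (c * v))%:~R / c - v| <= c^-1.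
Proof.
move=> c_gt0; rewrite -{2}(mulKf (lt0r_neq0 c_gt0) v) mulrC -mulrBr normrM.
rewrite gtr0_norm ?invr_gt0// ler_piMr ?invr_ge0 1?ltW// distrC.
have /andP[kv vk] := floor_itv (c * v); rewrite ger0_norm ?subr_ge0//.
by rewrite ltrBlDl -intrD1.
Qed.

(* Conditioning contracts the L^1 distance, so replacing the parameter [v] by a
   nearby grid point costs the same small amount for all [v] at once. *)
Lemma jointly_measurable_version (D L : Om -> R) (phi : R -> R) :
  (forall w, 0 <= D w) -> P.-integrable setT (EFin \o D) ->
  measurable_fun setT L -> measurable_fun setT phi ->
  (forall x, `|phi x| <= 1) -> (forall x y, `|phi x - phi y| <= `|x - y|) ->
  exists2 Y : R -> Om' -> R,
    measurable_fun setT (fun p : measurableTypeR R * Om' => Y p.1 p.2) &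
    forall v, cond_version P pi (fun w => D w * phi (v * L w)) (Y v).
Proof.
move=> D0 iD mL mphi phi1 phiL.
have mD : measurable_fun setT D by apply/measurable_EFinP; exact: measurable_int iD.
pose X v w := D w * phi (v * L w).
have mX v : measurable_fun setT (X v).
  apply: measurable_funM => //; apply: (measurableT_comp mphi).
  exact: measurable_funM.
have iX v : P.-integrable setT (EFin \o X v).
  apply: le_integrable iD => //; first exact/measurable_EFinP.
  by move=> w _ /=; rewrite lee_fin normrM ler_piMr.
have /choice[Z XZ] : forall v, exists Z, cond_version P pi (X v) Z.
  by move=> v; exact: cond_version_ex.
have mZ v : measurable_fun setT (Z v) by case: (XZ v).
have mZpi v : measurable_fun setT (fun w => Z v (pi w)).
  exact: (measurableT_comp (mZ v) (measurable_funPT pi)).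
(* [b n] dominates [|X u - X v|] as soon as [|u - v| <= 1 / n.+1]: the entry 2 comes from
   [|phi| <= 1], the other from the Lipschitz bound. The minimum keeps [b n] below the integrable
   function [2 D]. *)
pose b n w := D w * Num.min 2 (`|L w| / n.+1%:R).
have b0 n w : 0 <= b n w by rewrite mulr_ge0// le_min ler0n/= divr_ge0.
have mb n : measurable_fun setT (b n).
  apply: measurable_funM => //; apply: measurable_minr => //.
  by apply: measurable_funM => //; exact: measurableT_comp.
have e0 : (\int[P]_w (b n w)%:E)%E @[n --> \oo] --> 0%E.
  have := @dominated_cvg _ _ _ P _ measurableT (fun n w => (b n w)%:E) (cst 0%E)
    (fun w => (2 * D w)%:E).
  rewrite integral_cst// mul0e; apply.
  - by move=> n; exact/measurable_EFinP.
  - move=> w _; apply: cvg_EFin; first exact: nearW.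
    rewrite -(mulr0 (D w)); apply: cvgM; first exact: cvg_cst.
    apply: (@squeeze_cvgr _ _ _ _ (cst 0) (fun n => `|L w| / n.+1%:R)).
    + apply: nearW => n; rewrite /= le_min ler0n/= divr_ge0//=.
      by rewrite ge_min lexx orbT.
    + exact: cvg_cst.
    + rewrite -(mulr0 `|L w|); apply: cvgM; [exact: cvg_cst|exact: cvg_harmonic].
  - by [].
  - exact: (integrableZl measurableT 2 iD).
  - move=> n w _ /=; rewrite lee_fin ger0_norm// (mulrC 2) ler_wpM2l//.
    by rewrite ge_min lexx.
(* The mesh is refined fast enough for the errors to be summable, as [ae_cvg_of_summable]
   requires. *)
have [N NE] : exists N : nat -> nat, forall j,
    (\int[P]_w (b (N j) w)%:E <= (1 / (2 ^ j.+1)%:R)%:E)%E.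
  suff : forall j, exists n, (\int[P]_w (b n w)%:E <= (1 / (2 ^ j.+1)%:R)%:E)%E.
    by move=> /choice[N NE]; exists N.
  move=> j; set e := 1 / _.
  have e_gt0 : 0 < e by rewrite divr_gt0// ltr0n expn_gt0.
  have /fine_cvgP[fin] : (\int[P]_w (b n w)%:E)%E @[n --> \oo] --> 0%:E by [].
  move=> /cvgrPdist_lt/(_ _ e_gt0) lte.
  have [n _ /(_ n (leqnn _))[finn]] := filterI fin lte.
  rewrite /= sub0r normrN => /ltW; exists n.
  rewrite -(fineK finn) lee_fin; exact: le_trans (ler_norm _) _.
pose c j : R := (N j).+1%:R.
have c_gt0 j : 0 < c j by rewrite ltr0n.
(* For each [j] only the versions at the countably many points of the grid of mesh [1 / c j]
   enter. *)
pose f j (p : measurableTypeR R * Om') := Z ((Num.floor (c j * p.1))%:~R / c j) p.2.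
have mf j : measurable_fun setT (f j).
  by apply: (measurable_floor_grid (Z := fun k => Z (k%:~R / c j))) => k.
have [Y mY YE] := measurable_limit mf.
exists (fun v x => Y (v, x)).
  by rewrite (_ : (fun p => _) = Y)//; apply/funext => -[].
move=> v.
have mYv : measurable_fun setT (fun x => Y (v, x)).
  exact: (measurableT_comp mY (pair1_measurable (v : measurableTypeR R))).
apply: cond_version_ae mYv _ (XZ v).
(* For a fixed [v] the grid values converge almost surely to the version [Z v]. Hence [Y] at [v]
   equals [Z v] almost surely, with a null set that may depend on [v]. *)
have : {ae P, forall w, f j (v, pi w) @[j --> \oo] --> Z v (pi w)}.
  apply: ae_cvg_of_summable.
  - by move=> j; rewrite /f /=; exact: mZpi.
  - exact: mZpi.
  - move=> j; apply: le_trans (NE j).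
    set q := (Num.floor (c j * v))%:~R / c j.
    apply: le_trans (cond_version_contraction (cond_versionB (XZ q) (XZ v))) _.
    apply: ge0_le_integral => //.
    + apply: measurableT_comp => //; apply/measurable_EFinP.
      by apply: measurable_funB; exact: mX.
    + exact/measurable_EFinP.
    + move=> w _; rewrite lee_fin -mulrBr normrM ger0_norm// ler_wpM2l//.
      rewrite le_min; apply/andP; split.
        apply: le_trans (ler_normB _ _) _.
        by apply: le_trans (lerD (phi1 _) (phi1 _)) _.
      apply: le_trans (phiL _ _) _.
      rewrite -mulrBl normrM mulrC ler_wpM2l//.
      exact: floor_grid_dist.
apply: filterS => w fw; exact/esym/YE.
Qed.

End Jointly_measurable_versions.

(** * Complex conditional expectations *)

Section Complex_conditional_expectation.
Context {d d' : measure_display} {Om : measurableType d} {Om' : measurableType d'}.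
Context {R : realType}.
Variables (P : probability Om R) (pi : {mfun Om >-> Om'}).
Implicit Types (X : Om -> R[i]) (Y K : Om' -> R[i]).

Definition ccond_version X Y : Prop :=
  cond_version P pi (fun w => complex.Re (X w)) (fun x => complex.Re (Y x)) /\
  cond_version P pi (fun w => complex.Im (X w)) (fun x => complex.Im (Y x)).

Lemma complex_ext (x y : R[i]) :
  complex.Re x = complex.Re y -> complex.Im x = complex.Im y -> x = y.
Proof. by case: x y => [a b] [a' b'] /= -> ->. Qed.

Lemma ReD (x y : R[i]) : complex.Re (x + y) = complex.Re x + complex.Re y.
Proof. by case: x y => [a b] [a' b']. Qed.

Lemma ImD (x y : R[i]) : complex.Im (x + y) = complex.Im x + complex.Im y.
Proof. by case: x y => [a b] [a' b']. Qed.

Lemma ReM (x y : R[i]) : complex.Re (x * y) =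
  complex.Re x * complex.Re y - complex.Im x * complex.Im y.
Proof. by case: x y => [a b] [a' b']. Qed.

Lemma ImM (x y : R[i]) : complex.Im (x * y) =
  complex.Re x * complex.Im y + complex.Im x * complex.Re y.
Proof. by case: x y => [a b] [a' b']. Qed.

Lemma ccond_version_unique X Y1 Y2 : ccond_version X Y1 -> ccond_version X Y2 ->
  {ae P, forall w, Y1 (pi w) = Y2 (pi w)}.
Proof.
move=> [re1 im1] [re2 im2].
apply: filterS2 (cond_version_unique re1 re2) (cond_version_unique im1 im2).
by move=> w; exact: complex_ext.
Qed.

Lemma ccond_versionD X1 X2 Y1 Y2 : ccond_version X1 Y1 -> ccond_version X2 Y2 ->
  ccond_version (fun w => X1 w + X2 w) (fun x => Y1 x + Y2 x).
Proof.
move=> [re1 im1] [re2 im2]; split.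
  have := cond_versionD re1 re2.
  by congr cond_version; apply/funext => w; rewrite ReD.
have := cond_versionD im1 im2.
by congr cond_version; apply/funext => w; rewrite ImD.
Qed.

Lemma ccond_version_real (X : Om -> R) (Y : Om' -> R) : cond_version P pi X Y ->
  ccond_version (fun w => (X w)%:C) (fun x => (Y x)%:C).
Proof. by move=> XY; split => //=; exact: cond_version_cst. Qed.

(** A complex product consists of four real ones. The common bound [k * D] makes each of them
    integrable, so the real rule applies to each separately. *)
Lemma ccond_version_pull_out X Y K (k D : Om -> R) :
  measurable_fun setT (fun x => complex.Re (K x)) ->
  measurable_fun setT (fun x => complex.Im (K x)) ->
  (forall w, `|complex.Re (K (pi w))| <= k w) ->
  (forall w, `|complex.Im (K (pi w))| <= k w) ->
  (forall w, `|complex.Re (X w)| <= D w) ->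
  (forall w, `|complex.Im (X w)| <= D w) ->
  P.-integrable setT (fun w => (k w * D w)%:E) ->
  ccond_version X Y ->
  ccond_version (fun w => K (pi w) * X w) (fun x => K x * Y x).
Proof.
move=> mKr mKi Krk Kik XrD XiD ikD [XYr XYi].
have int (u v : Om -> R) : measurable_fun setT u -> measurable_fun setT v ->
    (forall w, `|u w| <= k w) -> (forall w, `|v w| <= D w) ->
    P.-integrable setT (fun w => (u w * v w)%:E).
  move=> mu mv uk vD; apply: le_integrable ikD => //.
    exact/measurable_EFinP/measurable_funM.
  move=> w _ /=; rewrite lee_fin normrM (le_trans (ler_pM _ _ (uk w) (vD w)))//.
  exact: ler_norm.
have mKr' := measurableT_comp mKr (measurable_funPT pi).
have mKi' := measurableT_comp mKi (measurable_funPT pi).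
have mXr : measurable_fun setT (fun w => complex.Re (X w)).
  by case: XYr => _ /measurable_int/measurable_EFinP.
have mXi : measurable_fun setT (fun w => complex.Im (X w)).
  by case: XYi => _ /measurable_int/measurable_EFinP.
split.
  have := cond_versionB (cond_version_pull_out mKr (int _ _ mKr' mXr Krk XrD) XYr)
    (cond_version_pull_out mKi (int _ _ mKi' mXi Kik XiD) XYi).
  by congr cond_version; apply/funext => w; rewrite ReM.
have := cond_versionD (cond_version_pull_out mKr (int _ _ mKr' mXi Krk XiD) XYi)
  (cond_version_pull_out mKi (int _ _ mKi' mXr Kik XrD) XYr).
by congr cond_version; apply/funext => w; rewrite ImM.
Qed.

Lemma ccond_version_cintegral {d1} {V : measurableType d1}
    (zeta : complex_measure V R) (X : V -> Om -> R[i]) (Y : V -> Om' -> R[i]) (C : R) :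
  measurable_fun setT (fun p : V * Om => complex.Re (X p.1 p.2)) ->
  measurable_fun setT (fun p : V * Om => complex.Im (X p.1 p.2)) ->
  measurable_fun setT (fun p : V * Om' => complex.Re (Y p.1 p.2)) ->
  measurable_fun setT (fun p : V * Om' => complex.Im (Y p.1 p.2)) ->
  (forall v, ccond_version (X v) (Y v)) ->
  (forall v, \int[P]_w `|(complex.Re (X v w))%:E| <= C%:E)%E ->
  (forall v, \int[P]_w `|(complex.Im (X v w))%:E| <= C%:E)%E ->
  {ae P, forall w, cintegrable zeta (fun v => Y v (pi w))} /\
  ccond_version (fun w => cintegral zeta (X^~ w)) (fun x => cintegral zeta (Y^~ x)).
Proof.
move=> mXr mXi mYr mYi XY XrC XiC.
have XYr v := (XY v).1; have XYi v := (XY v).2.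
have [irr rr] := cond_version_charge_integral mXr mYr XYr XrC (cm_re zeta).
have [iir ir] := cond_version_charge_integral mXr mYr XYr XrC (cm_im zeta).
have [iri ri] := cond_version_charge_integral mXi mYi XYi XiC (cm_re zeta).
have [iii ii] := cond_version_charge_integral mXi mYi XYi XiC (cm_im zeta).
split; last first.
  split; [exact: (cond_versionB rr ii)|exact: (cond_versionD ri ir)].
by apply: filterS2 (filterI irr iri) (filterI iir iii) => w [? ?] [? ?].
Qed.

End Complex_conditional_expectation.

(** * Riemann sums against the averaging measure *)

Section Riemann_sums.
Context {R : realType}.
Variables (g : probability (measurableTypeR R) R) (T s : R) (D : set R).
Hypotheses (T_gt0 : 0 < T) (s_ge0 : 0 <= s) (s_le : s <= T).
Hypothesis D_sub : D `<=` `[0, s].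
Hypothesis mD : measurable (D : set (measurableTypeR R)).

(** The cells are half-open of length [T / n.+1], and the endpoint [T] falls into the one of index
    [n.+1]. This is why the sums have [n.+2] terms. *)
Definition cell n k : set R := `[T / n.+1%:R * k%:R, T / n.+1%:R * k.+1%:R[%classic.

(* Truncating at [s] keeps all the nodes in [0, s] without changing those of the
   cells that meet [D]. *)
Definition node n k : R := Num.min s (T / n.+1%:R * k%:R).

Definition weight n k : R := fine (g (cell n k `&` D)).

Let step_gt0 n : 0 < T / n.+1%:R.
Proof. by rewrite divr_gt0// ltr0n. Qed.

Lemma node_itv n k : 0 <= node n k <= s.
Proof. by rewrite /node le_min s_ge0/= mulr_ge0 ?(ltW (step_gt0 n))//= ge_min lexx. Qed.

Lemma weight_ge0 n k : 0 <= weight n k.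
Proof. exact: fine_ge0. Qed.

Let mcell n k : measurable (cell n k : set (measurableTypeR R)).
Proof. exact: measurable_itv. Qed.

Lemma integral_step n (c : nat -> R) :
  (\int[g]_(u in D) (\sum_(k < n.+2) c k * \1_(cell n k) u)%:E
   = (\sum_(k < n.+2) c k * weight n k)%:E)%E.
Proof.
have i1 k : g.-integrable D (fun u => (\1_(cell n k) u)%:E).
  exact: (integrableS measurableT mD (@subsetT _ _) (integrable_indic _ _)).
under eq_integral do rewrite -sumEFin.
rewrite integral_sum//; last first.
  by move=> k; exact: (integrableZl mD (c k) (i1 k)).
rewrite -sumEFin; apply: eq_bigr => k _.
under eq_integral do rewrite EFinM.
rewrite integralZl// integral_indic// EFinM /weight fineK//.
by apply: fin_num_measure; exact: measurableI.
Qed.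

Lemma step_eval n u : 0 <= u <= T -> exists k : 'I_n.+2,
  u \in cell n k /\ forall c : nat -> R, \sum_(j < n.+2) c j * \1_(cell n j) u = c k.
Proof.
move=> /andP[u0 uT].
have h0 := step_gt0 n; have hN0 := lt0r_neq0 h0.
pose x := u / (T / n.+1%:R).
have x0 : 0 <= x by rewrite divr_ge0// ltW.
have ux : u = T / n.+1%:R * x by rewrite mulrC divfK.
have cellE k : (u \in cell n k) = (Num.trunc x == k).
  by rewrite truncn_eq// /cell mem_setE in_itv/= [in LHS]ux ler_pM2l// ltr_pM2l.
have xn : (Num.trunc x < n.+2)%N.
  rewrite -(ltr_nat R); have /andP[+ _] := truncn_itv x0; move=> /le_lt_trans; apply.
  rewrite (le_lt_trans (y := n.+1%:R))// ?ltr_nat//.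
  by rewrite ler_pdivrMr// mulrC divfK// pnatr_eq0.
exists (Ordinal xn); split; first by rewrite cellE/=.
move=> c; rewrite (bigD1 (Ordinal xn))//= big1 ?addr0.
  by rewrite indicE cellE eqxx mulr1.
move=> j jx; rewrite indicE cellE; case: eqP => [xj|_]; last by rewrite mulr0.
by move/negP : jx; case; apply/eqP/val_inj; rewrite /= -xj.
Qed.

(** The sum is [g D], the integral over [D] of the step function with all values 1. It can be less
    than 1, for instance when [D] is []t, T]]. *)
Lemma sum_weight_le1 n : \sum_(k < n.+2) weight n k <= 1.
Proof.
rewrite -lee_fin.
have -> : \sum_(k < n.+2) weight n k = \sum_(k < n.+2) (fun=> 1) (k : nat) * weight n k.
  by apply: eq_bigr => k _; rewrite mul1r.
rewrite -(integral_step n (fun=> 1)) (eq_integral (cst 1%E)).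
  by rewrite integral_cst// mul1e probability_le1.
move=> u; rewrite inE => /D_sub /=; rewrite in_itv/= => /andP[u0 us].
have [|k [_ E]] := @step_eval n u; first by rewrite u0 (le_trans us).
by congr EFin; exact: (E (fun=> 1)).
Qed.

Lemma cvg_node u (k : nat -> nat) : D u -> (forall n, u \in cell n (k n)) ->
  node n (k n) @[n --> \oo] --> u.
Proof.
move=> Du uk.
apply: (@squeeze_cvgr _ _ _ _ (fun n => u - T / n.+1%:R) (fun=> u)); last exact: cvg_cst.
  apply: nearW => n; have := uk n; rewrite /cell mem_setE in_itv/= => /andP[ku uk'].
  have /andP[_ us] : 0 <= u <= s by have := D_sub Du; rewrite /= in_itv.
  rewrite /node min_r; last exact: le_trans us.
  rewrite ku andbT lerBlDr -[X in _ + X]mulr1 -mulrDr.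
  by rewrite (_ : (k n)%:R + 1 = (k n).+1%:R) ?ltW// -natr1.
rewrite -[X in _ --> X]subr0; apply: cvgB; first exact: cvg_cst.
rewrite -(mulr0 T); apply: cvgM; [exact: cvg_cst|exact: cvg_harmonic].
Qed.

Variable phi : R -> R.
Hypothesis cphi : {within `[0, s], continuous phi}.

Let phi_bounded : exists M : R, forall u : R, 0 <= u <= s -> `|phi u| <= M.
Proof.
have [a _ Ha] := EVT_max s_ge0 cphi; have [b _ Hb] := EVT_min s_ge0 cphi.
exists (Num.max (phi a) (- phi b)) => u us; rewrite ler_norml.
have uI : u \in `[0, s] by rewrite in_itv.
by rewrite le_max Ha// andbT lerNl le_max lerN2 Hb// orbT.
Qed.

Lemma integrable_continuous : g.-integrable D (EFin \o phi).
Proof.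
have [M phiM] := phi_bounded.
apply: measurable_bounded_integrable => //.
- by rewrite (le_lt_trans (probability_le1 _ _)) ?ltry.
- have := @subspace_continuous_measurable_fun R `[0, s]%classic phi (measurable_itv _) cphi.
  by apply: measurable_funS => //; exact: measurable_itv.
- exists M; split; first exact: num_real.
  move=> x Mx u /D_sub; rewrite /= in_itv/= => us.
  by apply: (le_trans (phiM _ us)); exact: ltW.
Qed.

(** As [g] is arbitrary and may have atoms, each sum is read as the integral of a step function,
    with exact masses of the cells, and dominated convergence applies: a continuous [phi] is bounded
    on [[0, s]]. *)
Lemma cvg_Riemann_sum :
  \sum_(k < n.+2) phi (node n k) * weight n k @[n --> \oo] --> \int[g]_(u in D) phi u.
Proof.
have [M phiM] := phi_bounded.
suff : (\int[g]_(u in D) (\sum_(k < n.+2) phi (node n k) * \1_(cell n k) u)%:E)%E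
    @[n --> \oo] --> (\int[g]_(u in D) (phi u)%:E)%E.
  rewrite -[X in _ --> X]fineK; last exact: integrable_fin_num integrable_continuous.
  move=> /fine_cvgP[_]; apply: cvg_trans; apply: near_eq_cvg; apply: nearW => n /=.
  by rewrite (integral_step n (fun k => phi (node n k))).
have evalD n u : D u -> exists k : nat, u \in cell n k /\
    \sum_(j < n.+2) phi (node n j) * \1_(cell n j) u = phi (node n k).
  move=> /D_sub; rewrite /= in_itv/= => /andP[u0 us].
  have [|k [uk E]] := @step_eval n u; first by rewrite u0 (le_trans us).
  by exists k; split => //; exact: (E (fun k => phi (node n k))).
apply: (@dominated_cvg _ _ _ g D mD _ _ (cst M%:E)) => //.
- move=> n; apply/measurable_EFinP; apply: measurable_sum => k.
  exact: measurable_funM.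
- move=> u Du; have [k uk] := choice (fun n => @evalD n u Du).
  apply: cvg_EFin; first exact: nearW.
  have -> : (fine \o (fun n => (\sum_(j < n.+2) phi (node n j) * \1_(cell n j) u)%:E))
      = (fun n => phi (node n (k n))).
    by apply/funext => n /=; case: (uk n).
  (* Continuity is only relative to [[0, s]], so the nodes must stay in this interval; the
     truncation in [node] ensures it. *)
  have /subspace_continuousP/(_ u (D_sub Du)) := cphi.
  apply: (cvg_comp (fun n => node n (k n))) => A.
  rewrite /within /= => uA.
  have near_A : \forall n \near \oo, `[0, s]%classic (node n (k n)) -> A (node n (k n)).
    exact: (cvg_node Du (fun n => (uk n).1) uA).
  apply: filterS near_A => n; apply; rewrite /= in_itv /=; exact: node_itv.
- exact: finite_measure_integrable_cst.
- move=> n u Du /=; have [k [_ ->]] := @evalD n u Du.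
  by rewrite lee_fin phiM// node_itv.
Qed.

End Riemann_sums.

(** * Measurability and integrability of geometric averages *)

Section Geometric_average_of_a_process.
Context {R : realType}.

(* AM-GM, where the missing weight [1 - \sum p] is put on the value [exp 0]. *)
Lemma expR_weighted_sum (n : nat) (p x : nat -> R) :
  (forall k, 0 <= p k) -> \sum_(k < n) p k <= 1 ->
  expR (\sum_(k < n) x k * p k) <= \sum_(k < n) expR (x k) * p k + 1.
Proof.
move=> p0 p1; set m := \sum_(k < n) x k * p k; set q := \sum_(k < n) p k in p1.
(* The tangent of the exponential at the mean [m]. Weighted by the [p k] at [x k], it gives [h1];
   weighted by the missing mass [1 - q] at 0, it gives [h2]. The left-hand sides add up to
   [exp m]. *)
have tangent y : expR m * (1 + (y - m)) <= expR y.
  rewrite -[X in _ <= expR X](subrKC m) expRD ler_pM2l ?expR_gt0//.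
  exact: expR_ge1Dx.
have h1 : expR m * (q + (m - q * m)) <= \sum_(k < n) expR (x k) * p k.
  rewrite [X in _ * X](_ : _ = \sum_(k < n) (1 + (x k - m)) * p k).
    rewrite mulr_sumr; apply: ler_sum => k _.
    by rewrite mulrA ler_wpM2r.
  under eq_bigr do rewrite mulrDl mul1r mulrBl.
  by rewrite big_split/= sumrB -mulr_sumr [m * _]mulrC.
have h2 : (1 - q) * (expR m * (1 - m)) <= 1 - q.
  rewrite ler_piMr ?subr_ge0//.
  by have := tangent 0; rewrite sub0r expR0.
have q0 : 0 <= q by exact: sumr_ge0.
rewrite [leLHS](_ : _ = expR m * (q + (m - q * m)) + (1 - q) * (expR m * (1 - m))).
  apply: lerD => //; apply: le_trans h2 _.
  by rewrite gerBl.
ring.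
Qed.

Lemma limn_einf_le (u : nat -> \bar R) (C : \bar R) :
  (forall n, u n <= C)%E -> (limn_einf u <= C)%E.
Proof.
move=> uC; rewrite limn_einf_lim; apply: lime_le; first exact: is_cvg_einfs.
apply: nearW => n; apply: le_trans (uC n).
by apply: ereal_inf_lbound; exists n => //=.
Qed.

(** The 1 accounts for the default value [ln x = 0] at [x <= 0]; thanks to it the bound holds at
    every outcome, also where a price fails to be positive. *)
Lemma expR_ln_le (x : R) : expR (ln x) <= `|x| + 1.
Proof.
have [x0|x0] := ltP 0 x.
  by rewrite lnK ?posrE// (le_trans (ler_norm _))// lerDl.
by rewrite ln0// expR0 lerDr.
Qed.

Context {d d' : measure_display} {Om : measurableType d} {U : measurableType d'}.
Variables (g : probability (measurableTypeR R) R) (T s : R) (D : set R).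
Hypotheses (T_gt0 : 0 < T) (s_ge0 : 0 <= s) (s_le : s <= T).
Hypothesis D_sub : D `<=` `[0, s].
Hypothesis mD : measurable (D : set (measurableTypeR R)).

Definition regular_path (S : R -> R) :=
  {within `[0, s], continuous S} /\ forall u, 0 <= u <= s -> 0 < S u.

Lemma continuous_ln_path (S : R -> R) : regular_path S ->
  {within `[0, s], continuous (fun u => ln (S u))}.
Proof.
move=> [cS S0]; apply: (@within_continuous_comp _ _ _ _ S (@ln R)) cS.
move=> y; rewrite inE /= => -[u us <-]; apply: continuous_ln; apply: S0.
by move: us; rewrite /= in_itv.
Qed.

(** The Riemann sums involve the process only up to time [s]. The space [U] is left free so that it
    can be [Om] with its full structure or with that of [F t]; in the second case [L] is
    [F t]-measurable. *)
Lemma measurable_log_average (S : R -> U -> R) :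
  (forall u, 0 <= u <= s -> measurable_fun setT (S u)) ->
  exists2 L : U -> R, measurable_fun setT L &
    forall w, regular_path (S^~ w) -> L w = \int[g]_(u in D) ln (S u w).
Proof.
move=> mS.
have mRS n : measurable_fun setT
    (fun w => \sum_(k < n.+2) ln (S (node T s n k) w) * weight g T D n k).
  apply: measurable_sum => k; apply: measurable_funM => //.
  by apply: (measurableT_comp (@measurable_ln R)); exact/mS/node_itv.
have [L mL LE] := measurable_limit mRS.
exists L => // w rS; apply: LE.
exact: (@cvg_Riemann_sum _ g T s D) (continuous_ln_path rS).
Qed.

Lemma integrable_geometric_average (P : probability Om R) (S : R -> Om -> R)
    (L : Om -> R) (C : R) :
  (forall u, 0 <= u <= s -> measurable_fun setT (S u)) ->
  (forall u, 0 <= u <= s -> (\int[P]_w `|(S u w)%:E| <= C%:E)%E) ->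
  {ae P, forall w, regular_path (S^~ w)} ->
  measurable_fun setT L ->
  {ae P, forall w, L w = \int[g]_(u in D) ln (S u w)} ->
  P.-integrable setT (fun w => (expR (L w))%:E).
Proof.
move=> mS SC rS mL LE.
have C0 : 0 <= C.
  by rewrite -lee_fin (le_trans _ (SC s _)) ?integral_ge0// s_ge0 lexx.
pose p n k := weight g T D n k.
have p0 n k : 0 <= p n k by exact: weight_ge0.
have p1 n : \sum_(k < n.+2) p n k <= 1 by exact: (@sum_weight_le1 _ g T s).
pose X n w := \sum_(k < n.+2) ln (S (node T s n k) w) * p n k.
(* One unit of the 2 is the missing mass in [expR_weighted_sum]; the other is the 1 of [expR_ln_le],
   weighted by a total mass of at most 1. *)
pose B n w := \sum_(k < n.+2) (`|S (node T s n k) w| * p n k) + 2.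
have mSn n k : measurable_fun setT (S (node T s n k)) by exact/mS/node_itv.
have mX n : measurable_fun setT (X n).
  apply: measurable_sum => k; apply: measurable_funM => //.
  exact: (measurableT_comp (@measurable_ln R)).
have mSpn n k : measurable_fun setT (fun w => `|S (node T s n k) w| * p n k).
  by apply: measurable_funM => //; exact: measurableT_comp.
have mB n : measurable_fun setT (B n).
  by apply: measurable_funD => //; exact: measurable_sum.
have meX n : measurable_fun setT (fun w => expR (X n w)).
  exact: (measurableT_comp (@measurable_expR R)).
have meL : measurable_fun setT (fun w => expR (L w)).
  exact: (measurableT_comp (@measurable_expR R)).
have XB n w : expR (X n w) <= B n w.
  apply: (le_trans (expR_weighted_sum (fun k => ln (S (node T s n k) w)) (p0 n) (p1 n))).
  rewrite /B (_ : 2 = 1 + 1)// addrA lerD2r.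
  apply: (@le_trans _ _ (\sum_(k < n.+2) (`|S (node T s n k) w| * p n k + p n k))).
    apply: ler_sum => k _; rewrite -[X in _ + X]mul1r -mulrDl ler_wpM2r//.
    exact: expR_ln_le.
  by rewrite big_split/= lerD2l; exact: p1.
have iB n : (\int[P]_w (B n w)%:E <= (C + 2)%:E)%E.
  under eq_integral do rewrite EFinD -sumEFin.
  rewrite ge0_integralD//; last 2 first.
    by move=> w _; apply: sume_ge0 => k _; rewrite lee_fin mulr_ge0.
    by apply: emeasurable_sum => k; exact/measurable_EFinP.
  rewrite integral_cst// (EFinD C) leeD//; last first.
    by rewrite -[leRHS]mule1 lee_wpmul2l// probability_le1.
  rewrite ge0_integral_sum//; last 2 first.
    by move=> k; exact/measurable_EFinP.
    by move=> k w _; rewrite lee_fin mulr_ge0.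
  apply: (@le_trans _ _ (\sum_(k < n.+2) (C * p n k)%:E)%E).
    apply: lee_sum => k _; under eq_integral do rewrite EFinM.
    rewrite ge0_integralZr ?lee_fin//; last first.
      by apply/measurable_EFinP; exact: measurableT_comp.
    rewrite EFinM lee_wpmul2r ?lee_fin//.
    exact/SC/node_itv.
  rewrite sumEFin lee_fin -mulr_sumr -[leRHS]mulr1 ler_wpM2l//.
have lim : {ae P, forall w, limn_einf (fun n => (expR (X n w))%:E) = (expR (L w))%:E}.
  apply: filterS2 rS LE => w rSw Lw.
  have Xw : X n w @[n --> \oo] --> L w.
    rewrite Lw; exact: (@cvg_Riemann_sum _ g T s D) (continuous_ln_path rSw).
  have : (expR (X n w))%:E @[n --> \oo] --> (expR (L w))%:E.
    apply: cvg_EFin; first exact: nearW.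
    have : expR (X n w) @[n --> \oo] --> expR (L w).
      by apply: continuous_cvg Xw; exact: continuous_expR.
    exact: cvg_trans.
  by move=> /cvg_limn_einf_sup[].
apply/integrableP; split; first exact/measurable_EFinP.
rewrite (eq_integral (fun w => (expR (L w))%:E)); last first.
  by move=> w _; rewrite /= ger0_norm// expR_ge0.
have -> : (\int[P]_w (expR (L w))%:E =
    \int[P]_w limn_einf (fun n => (expR (X n w))%:E))%E.
  apply: ae_eq_integral => //.
  - exact/measurable_EFinP.
  - apply: measurableT_comp => //; apply: measurable_fun_limn_esup => n.
    by apply: measurableT_comp => //; exact/measurable_EFinP.
  - by move: lim; apply: filterS => w ->.
apply: (@le_lt_trans _ _ (C + 2)%:E); last exact: ltry.
apply: le_trans (fatou _ _ _ _) _ => //.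
- by move=> n; exact/measurable_EFinP.
- apply: limn_einf_le => n; apply: le_trans (iB n).
  apply: ge0_le_integral => //.
  + exact/measurable_EFinP.
  + exact/measurable_EFinP.
  + by move=> w _; rewrite lee_fin XB.
Qed.

End Geometric_average_of_a_process.

(** * Complex powers as oscillations *)

Section Oscillating_integrands.
Context {R : realType}.

(* [osc d l v] is [d e^{ivl}]. *)
Definition osc (d l v : R) : R[i] := (d * cos (v * l)) +i* (d * sin (v * l)).

Lemma oscM (d1 l1 d2 l2 v : R) :
  osc d1 l1 v * osc d2 l2 v = osc (d1 * d2) (l1 + l2) v.
Proof.
rewrite /osc; apply: complex_ext; rewrite ?ReM ?ImM /= mulrDr ?cosD ?sinD; ring.
Qed.

Lemma normr_Re_osc (d l v : R) : 0 <= d -> `|complex.Re (osc d l v)| <= d.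
Proof. by move=> d0; rewrite /= normrM ger0_norm// ler_piMr// cos_max. Qed.

Lemma normr_Im_osc (d l v : R) : 0 <= d -> `|complex.Im (osc d l v)| <= d.
Proof. by move=> d0; rewrite /= normrM ger0_norm// ler_piMr// sin_max. Qed.

(** Along a vertical line only the frequency [Im z] varies, while the amplitude [exp (Re z * x)]
    stays fixed. All bounds uniform in [z] come from here. *)
Lemma cpow_expR (x : R) (z : R[i]) : cpow (expR x) z =
  osc (expR (complex.Re z * x)) x (complex.Im z).
Proof.
rewrite /cpow expRK /cexp /osc; apply: complex_ext.
- by rewrite ReM /= !ReM !ImM /= !mulr0 mul0r subr0 !subr0 add0r.
- by rewrite ImM /= !ReM !ImM /= !mulr0 mul0r subr0 addr0 add0r.
Qed.

Lemma cpow0 (x : R) : cpow x 0 = 1.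
Proof.
rewrite /cpow mul0r /cexp /= expR0 cos0 sin0.
by apply: complex_ext; rewrite /= ?mulr0 ?mulr1 ?subr0 ?addr0.
Qed.

Lemma cpow1 (x : R) : 0 < x -> cpow x 1 = x%:C.
Proof.
move=> x0; rewrite -[x in LHS](lnK x0) cpow_expR /osc /= !mul1r lnK//.
by rewrite !mul0r cos0 sin0 mulr1 mulr0.
Qed.

Lemma lipschitz1 (f df : R -> R) : (forall x : R, is_derive x 1 f (df x)) ->
  (forall x, `|df x| <= 1) -> forall x y, `|f x - f y| <= `|x - y|.
Proof.
move=> fdf df1.
suff ordered x y : x < y -> `|f x - f y| <= `|x - y|.
  move=> x y; have [xy|yx|->] := ltgtP x y; first exact: ordered.
  - by rewrite distrC [leRHS]distrC; exact: ordered.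
  - by rewrite !subrr.
move=> xy; rewrite distrC [leRHS]distrC.
have [|c _ ->] := MVT xy (fun z _ => fdf z).
  apply: continuous_subspaceT => z; apply: differentiable_continuous.
  by apply/derivable1_diffP; have [] := fdf z.
by rewrite normrM ler_piMl.
Qed.

Lemma lipschitz1_cos (x y : R) : `|cos x - cos y| <= `|x - y|.
Proof.
by apply: (lipschitz1 (fun z => is_derive_cos z)) => z; rewrite normrN sin_max.
Qed.

Lemma lipschitz1_sin (x y : R) : `|sin x - sin y| <= `|x - y|.
Proof. by apply: (lipschitz1 (fun z => is_derive_sin z)) => z; rewrite cos_max. Qed.

Lemma measurable_cos : measurable_fun setT (@cos R).
Proof. by apply: continuous_measurable_fun; exact: continuous_cos. Qed.

Lemma measurable_sin : measurable_fun setT (@sin R).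
Proof. by apply: continuous_measurable_fun; exact: continuous_sin. Qed.

Lemma measurable_osc {d} {U : measurableType d} (D L : U -> R) :
  measurable_fun setT D -> measurable_fun setT L ->
  measurable_fun setT (fun p : measurableTypeR R * U =>
    complex.Re (osc (D p.2) (L p.2) p.1)) /\
  measurable_fun setT (fun p : measurableTypeR R * U =>
    complex.Im (osc (D p.2) (L p.2) p.1)).
Proof.
move=> mD mL.
have mD2 : measurable_fun setT (fun p : measurableTypeR R * U => D p.2).
  exact: measurableT_comp.
have mvL : measurable_fun setT (fun p : measurableTypeR R * U => p.1 * L p.2).
  by apply: measurable_funM => //; exact: measurableT_comp.
split; apply: measurable_funM => //.
- exact: (measurableT_comp measurable_cos).
- exact: (measurableT_comp measurable_sin).
Qed.

Context {d d' : measure_display} {Om : measurableType d} {Om' : measurableType d'}.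
Variables (P : probability Om R) (pi : {mfun Om >-> Om'}).

Lemma osc_version (D L : Om -> R) :
  (forall w, 0 <= D w) -> P.-integrable setT (EFin \o D) -> measurable_fun setT L ->
  exists Y : R -> Om' -> R[i],
    [/\ measurable_fun setT (fun p : measurableTypeR R * Om' => complex.Re (Y p.1 p.2)),
        measurable_fun setT (fun p : measurableTypeR R * Om' => complex.Im (Y p.1 p.2)) &
        forall v, ccond_version P pi (fun w => osc (D w) (L w) v) (Y v)].
Proof.
move=> D0 iD mL.
have [Yr mYr XYr] := jointly_measurable_version pi D0 iD mL measurable_cos
  (@cos_max R) lipschitz1_cos.
have [Yi mYi XYi] := jointly_measurable_version pi D0 iD mL measurable_sin
  (@sin_max R) lipschitz1_sin.
exists (fun v x => Yr v x +i* Yi v x); split; [exact: mYr|exact: mYi|].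
by move=> v; split; [exact: XYr|exact: XYi].
Qed.

(** The known oscillation [osc kap K v] is taken out of the conditional expectation of [osc D L v].
    Their product has amplitude [kap * D] for every [v], and its expectation is the uniform bound
    needed for conditional Fubini. *)
Lemma osc_cintegral (zeta : complex_measure (measurableTypeR R) R)
    (D L : Om -> R) (kap K : Om' -> R) (Y : R -> Om' -> R[i]) :
  (forall w, 0 <= D w) -> measurable_fun setT D -> measurable_fun setT L ->
  (forall x, 0 <= kap x) -> measurable_fun setT kap -> measurable_fun setT K ->
  P.-integrable setT (fun w => (kap (pi w) * D w)%:E) ->
  measurable_fun setT (fun p : measurableTypeR R * Om' => complex.Re (Y p.1 p.2)) ->
  measurable_fun setT (fun p : measurableTypeR R * Om' => complex.Im (Y p.1 p.2)) ->
  (forall v, ccond_version P pi (fun w => osc (D w) (L w) v) (Y v)) ->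
  {ae P, forall w, cintegrable zeta
    (fun v => osc (kap (pi w)) (K (pi w)) v * Y v (pi w))} /\
  ccond_version P pi
    (fun w => cintegral zeta (fun v => osc (kap (pi w) * D w) (K (pi w) + L w) v))
    (fun x => cintegral zeta (fun v => osc (kap x) (K x) v * Y v x)).
Proof.
move=> D0 mD mL kap0 mkap mK ikD mYr mYi XY.
have kD0 w : 0 <= kap (pi w) * D w by rewrite mulr_ge0.
have mkpi := measurableT_comp mkap (measurable_funPT pi).
have mKpi := measurableT_comp mK (measurable_funPT pi).
have [mXr mXi] := measurable_osc (measurable_funM mkpi mD) (measurable_funD mKpi mL).
have [mKr mKi] := measurable_osc mkap mK.
pose C := fine (\int[P]_w (kap (pi w) * D w)%:E)%E.
have bound (f : Om -> R) : measurable_fun setT f ->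
    (forall w, `|f w| <= kap (pi w) * D w) -> (\int[P]_w `|(f w)%:E| <= C%:E)%E.
  move=> mf fkD; rewrite fineK; last exact: integrable_fin_num ikD.
  apply: ge0_le_integral => //.
  - by apply: measurableT_comp => //; exact/measurable_EFinP.
  - exact: measurable_int ikD.
  - by move=> w _; rewrite lee_fin.
apply: (@ccond_version_cintegral _ _ _ _ _ P pi _ _ zeta _ _ C).
- exact: mXr.
- exact: mXi.
- rewrite (_ : (fun p => _) = (fun p : measurableTypeR R * Om' =>
      complex.Re (osc (kap p.2) (K p.2) p.1) * complex.Re (Y p.1 p.2)
      - complex.Im (osc (kap p.2) (K p.2) p.1) * complex.Im (Y p.1 p.2))); last first.
    by apply/funext => p; rewrite ReM.
  by apply: measurable_funB; exact: measurable_funM.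
- rewrite (_ : (fun p => _) = (fun p : measurableTypeR R * Om' =>
      complex.Re (osc (kap p.2) (K p.2) p.1) * complex.Im (Y p.1 p.2)
      + complex.Im (osc (kap p.2) (K p.2) p.1) * complex.Re (Y p.1 p.2))); last first.
    by apply/funext => p; rewrite ImM.
  by apply: measurable_funD; exact: measurable_funM.
- move=> v; under eq_fun do rewrite -oscM.
  apply: (ccond_version_pull_out (K := fun x => osc (kap x) (K x) v)
    (k := fun w => kap (pi w)) (D := D)) => //.
  + exact: (measurableT_comp mKr (pair1_measurable (v : measurableTypeR R))).
  + exact: (measurableT_comp mKi (pair1_measurable (v : measurableTypeR R))).
  + by move=> w; exact: normr_Re_osc.
  + by move=> w; exact: normr_Im_osc.
  + by move=> w; exact: normr_Re_osc.
  + by move=> w; exact: normr_Im_osc.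
- move=> v; apply: bound => [|w]; last exact: normr_Re_osc.
  exact: (measurableT_comp mXr (pair1_measurable (v : measurableTypeR R))).
- move=> v; apply: bound => [|w]; last exact: normr_Im_osc.
  exact: (measurableT_comp mXi (pair1_measurable (v : measurableTypeR R))).
Qed.

End Oscillating_integrands.

(** * The pricing formula in logarithmic variables *)

Section Pricing_formula.
Context {R : realType} {d d' : measure_display}.
Context {Om : measurableType d} {Om' : measurableType d'}.
Variables (P : probability Om R) (pi : {mfun Om >-> Om'}).

Lemma cond_version_ae_left (X X' : Om -> R) (Y : Om' -> R) :
  measurable_fun setT X' -> {ae P, forall w, X w = X' w} ->
  cond_version P pi X Y -> cond_version P pi X' Y.
Proof.
move=> mX' XX' [mY iX iY YE].
have mX : measurable_fun setT X by apply/measurable_EFinP; exact: measurable_int iX.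
have ae A : ae_eq P A (EFin \o X) (EFin \o X').
  by move: XX'; apply: filterS => w /= ->.
split => //.
  apply/integrableP; split; first exact/measurable_EFinP.
  have -> : (\int[P]_w `|(EFin \o X') w| = \int[P]_w `|(EFin \o X) w|)%E.
    apply: ae_eq_integral => //.
    - by apply/measurableT_comp => //; exact/measurable_EFinP.
    - by apply/measurableT_comp => //; exact/measurable_EFinP.
    - exact/ae_eq_sym/ae_eq_abse/ae.
  by case/integrableP : iX.
move=> A mA; rewrite YE//; apply: ae_eq_integral.
- exact: measurable_funPTI.
- by apply: measurable_funTS; exact/measurable_EFinP.
- by apply: measurable_funTS; exact/measurable_EFinP.
- exact: ae.
Qed.

(** A convex combination is at most the larger of [x] and [y], whose exponential is one of the two
    terms. *)
Lemma expR_interpolation (rho x y : R) : 0 <= rho <= 1 ->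
  expR (rho * x + (1 - rho) * y) <= expR x + expR y.
Proof.
move=> /andP[rho0 rho1].
have [xy|/ltW yx] := leP x y.
  apply: (@le_trans _ _ (expR y)); last by rewrite lerDr expR_ge0.
  rewrite ler_expR [leRHS](_ : _ = rho * y + (1 - rho) * y); last by ring.
  by rewrite lerD2r ler_wpM2l.
apply: (@le_trans _ _ (expR x)); last by rewrite lerDl expR_ge0.
rewrite ler_expR [leRHS](_ : _ = rho * x + (1 - rho) * x); last by ring.
by rewrite lerD2l ler_wpM2l// subr_ge0.
Qed.

Lemma integrable_expR_interpolation (rho : R) (A B : Om -> R) : 0 <= rho <= 1 ->
  measurable_fun setT A -> measurable_fun setT B ->
  P.-integrable setT (fun w => (expR (A w))%:E) ->
  P.-integrable setT (fun w => (expR (B w))%:E) ->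
  P.-integrable setT (fun w => (expR (rho * A w + (1 - rho) * B w))%:E).
Proof.
move=> rho01 mA mB iA iB.
apply: le_integrable (integrableD measurableT iA iB) => //.
  apply/measurable_EFinP/(measurableT_comp (@measurable_expR R)).
  by apply: measurable_funD; exact: measurable_funM.
move=> w _ /=; rewrite lee_fin !ger0_norm ?addr_ge0 ?expR_ge0//.
exact: expR_interpolation.
Qed.

(** In the application [A], [B] and [K] are almost surely the logarithms of [G_{t,T}], [S_T] and
    [G_t], and [St] is [e^{r(T-t)} S_t]. *)
Variables (rho : R) (A B : Om -> R) (K St : Om' -> R).
Hypotheses (rho01 : 0 < rho < 1).
Hypotheses (mA : measurable_fun setT A) (mB : measurable_fun setT B).
Hypothesis mK : measurable_fun setT K.
Hypothesis iA : P.-integrable setT (fun w => (expR (A w))%:E).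
Hypothesis iKA : P.-integrable setT (fun w => (expR (K (pi w) + A w))%:E).
Hypothesis BSt : cond_version P pi (fun w => expR (B w)) St.

Definition power_versions (Psi : R[i] -> R[i] -> Om' -> R[i]) : Prop :=
  [/\ forall s u, psi_arg rho s u ->
        ccond_version P pi (fun w => cpow (expR (A w)) s * cpow (expR (B w)) u) (Psi s u),
      measurable_fun setT (fun p : measurableTypeR R * Om' =>
        complex.Re (Psi (rho +i* p.1) 0 p.2)) /\
      measurable_fun setT (fun p : measurableTypeR R * Om' =>
        complex.Im (Psi (rho +i* p.1) 0 p.2)) &
      measurable_fun setT (fun p : measurableTypeR R * Om' =>
        complex.Re (Psi (rho +i* p.1) (1 - (rho +i* p.1)) p.2)) /\
      measurable_fun setT (fun p : measurableTypeR R * Om' =>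
        complex.Im (Psi (rho +i* p.1) (1 - (rho +i* p.1)) p.2))].

Let rho_le : 0 <= rho <= 1.
Proof. by have /andP[? ?] := rho01; rewrite !ltW. Qed.

Let iB : P.-integrable setT (fun w => (expR (B w))%:E).
Proof. by case: BSt. Qed.

Let i1 : P.-integrable setT (fun w : Om => (expR 0)%:E).
Proof. exact: finite_measure_integrable_cst. Qed.

(** [D0] and [D1] are the moduli of [G_{t,T}^z] and of [G_{t,T}^z S_T^{1-z}] for [z] on the line. *)
Let D0 w := expR (rho * A w).
Let D1 w := expR (rho * A w + (1 - rho) * B w).

Let mD0 : measurable_fun setT D0.
Proof. by apply: (measurableT_comp (@measurable_expR R)); exact: measurable_funM. Qed.

Let mD1 : measurable_fun setT D1.
Proof.
apply: (measurableT_comp (@measurable_expR R)).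
by apply: measurable_funD; exact: measurable_funM.
Qed.

Let iD0 : P.-integrable setT (EFin \o D0).
Proof.
(* Interpolation between [A] and 0, so that [D0] is at most [exp A + 1]. *)
have := integrable_expR_interpolation rho_le mA (measurable_cst _) iA i1.
by under eq_fun do rewrite mulr0 addr0.
Qed.

Let iD1 : P.-integrable setT (EFin \o D1).
Proof. exact: integrable_expR_interpolation. Qed.

Let mAB : measurable_fun setT (fun w => A w - B w).
Proof. exact: measurable_funB. Qed.

Lemma cpow_line (x v : R) : cpow (expR x) (rho +i* v) = osc (expR (rho * x)) x v.
Proof. exact: cpow_expR. Qed.

Lemma cpow_coline (x v : R) :
  cpow (expR x) (1 - (rho +i* v)) = osc (expR ((1 - rho) * x)) (- x) v.
Proof. by rewrite cpow_expR /osc /= sub0r mulNr mulrN. Qed.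

Lemma cpow_line0 (x y v : R) : cpow (expR x) (rho +i* v) * cpow y 0 =
  osc (expR (rho * x)) x v.
Proof. by rewrite cpow0 mulr1 cpow_line. Qed.

Lemma cpow_lineM (x y v : R) :
  cpow (expR x) (rho +i* v) * cpow (expR y) (1 - (rho +i* v)) =
  osc (expR (rho * x + (1 - rho) * y)) (x - y) v.
Proof. by rewrite cpow_line cpow_coline oscM expRD. Qed.

(** Since [rho < 1], a point [s] of the line is never 1 and [1 - s] is never 0. The three kinds of
    arguments are thus disjoint, and [Psi] can be defined by cases from separately chosen
    versions. *)
Lemma power_versions_ex : exists Psi, power_versions Psi.
Proof.
have [Y10 XY10] := cond_version_ex pi iA.
have [Y0 [mY0r mY0i XY0]] := osc_version pi (fun w => expR_ge0 _) iD0 mA.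
have [Y1 [mY1r mY1i XY1]] := osc_version pi (fun w => expR_ge0 _) iD1 mAB.
have /andP[rho0 rho1] := rho01.
have rhoN1 v : (rho +i* v == 1) = false.
  by apply/negbTE/eqP => /(congr1 (@complex.Re R)) /= /eqP; rewrite lt_eqF.
have corhoN0 v : (1 - (rho +i* v) == 0) = false.
  apply/negbTE/eqP => /(congr1 (@complex.Re R)) /= /eqP.
  by rewrite subr_eq0 gt_eqF.
exists (fun s u x => if s == 1 then (Y10 x)%:C else
  if u == 0 then Y0 (complex.Im s) x else Y1 (complex.Im s) x); split.
- move=> s u [[-> ->]|[]].
    rewrite eqxx; have := ccond_version_real XY10.
    by congr ccond_version; apply/funext => w; rewrite cpow0 mulr1 cpow1 ?expR_gt0.
  case: s => r v /= ->; rewrite rhoN1 => -[->|->].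
    rewrite eqxx; have := XY0 v; congr ccond_version; apply/funext => w.
    by rewrite cpow_line0.
  rewrite corhoN0; have := XY1 v; congr ccond_version; apply/funext => w.
  by rewrite cpow_lineM.
- by split; under eq_fun do rewrite rhoN1 eqxx.
- by split; under eq_fun do rewrite rhoN1 corhoN0.
Qed.

Lemma ccond_version_payoff (zeta0 zeta1 : complex_measure (measurableTypeR R) R)
    (a b c : R) Psi : power_versions Psi ->
  let f0 x v := cpow (expR (K x)) (rho +i* v) * Psi (rho +i* v) 0 x in
  let f1 x v := cpow (expR (K x)) (rho +i* v) * Psi (rho +i* v) (1 - (rho +i* v)) x in
  {ae P, forall w, cintegrable zeta0 (f0 (pi w)) /\ cintegrable zeta1 (f1 (pi w))} /\
  ccond_version P pi
    (fun w => let x := expR (K (pi w) + A w) in let y := expR (B w) in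
      a%:C + b%:C * x%:C + c%:C * y%:C
      + cintegral zeta0 (fun v => cpow x (rho +i* v))
      + cintegral zeta1 (fun v => cpow x (rho +i* v) * cpow y (1 - (rho +i* v))))
    (fun x => a%:C + b%:C * (expR (K x))%:C * Psi 1 0 x + c%:C * (St x)%:C
      + cintegral zeta0 (f0 x) + cintegral zeta1 (f1 x)).
Proof.
move=> [PsiE [mPsi0r mPsi0i] [mPsi1r mPsi1i]] f0 f1.
have mkap : measurable_fun setT (fun x => expR (rho * K x)).
  by apply: (measurableT_comp (@measurable_expR R)); exact: measurable_funM.
have mKpi := measurableT_comp mK (measurable_funPT pi).
have mKA : measurable_fun setT (fun w => K (pi w) + A w) by exact: measurable_funD.
(* Taking out [G_t^z] requires the product to be integrable, so the interpolation is applied to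
   [K + A], the logarithm of [G_T]. *)
have ikD0 : P.-integrable setT (fun w => (expR (rho * K (pi w)) * D0 w)%:E).
  have := integrable_expR_interpolation rho_le mKA (measurable_cst _) iKA i1.
  by under eq_fun do rewrite mulr0 addr0 mulrDr expRD.
have ikD1 : P.-integrable setT (fun w => (expR (rho * K (pi w)) * D1 w)%:E).
  have := integrable_expR_interpolation rho_le mKA mB iKA iB.
  by under eq_fun do rewrite mulrDr -addrA expRD.
have XY0 v : ccond_version P pi (fun w => osc (D0 w) (A w) v) (Psi (rho +i* v) 0).
  have := PsiE (rho +i* v) 0 (or_intror (conj erefl (or_introl erefl))).
  by congr ccond_version; apply/funext => w; rewrite cpow_line0.
have XY1 v : ccond_version P pi (fun w => osc (D1 w) (A w - B w) v)
    (Psi (rho +i* v) (1 - (rho +i* v))).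
  have := PsiE (rho +i* v) _ (or_intror (conj erefl (or_intror erefl))).
  by congr ccond_version; apply/funext => w; rewrite cpow_lineM.
have [ae0 cv0] := osc_cintegral zeta0 (fun w => expR_ge0 _) mD0 mA
  (fun x => expR_ge0 _) mkap mK ikD0 mPsi0r mPsi0i XY0.
have [ae1 cv1] := osc_cintegral zeta1 (fun w => expR_ge0 _) mD1 mAB
  (fun x => expR_ge0 _) mkap mK ikD1 mPsi1r mPsi1i XY1.
split.
  apply: filterS2 ae0 ae1 => w; rewrite /f0 /f1.
  by split; under eq_fun do rewrite cpow_line.
have cvG : ccond_version P pi (fun w => b%:C * (expR (K (pi w) + A w))%:C)
    (fun x => b%:C * (expR (K x))%:C * Psi 1 0 x).
  have cA w : cpow (expR (A w)) 1 * cpow (expR (B w)) 0 = (expR (A w))%:C.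
    by rewrite cpow0 mulr1 cpow1 ?expR_gt0.
  have XA : ccond_version P pi (fun w => (expR (A w))%:C) (Psi 1 0).
    have := PsiE 1 0 (or_introl (conj erefl erefl)).
    by congr ccond_version; apply/funext => w; exact: cA.
  have -> : (fun w => b%:C * (expR (K (pi w) + A w))%:C) =
      (fun w => (b * expR (K (pi w)))%:C * (expR (A w))%:C).
    by apply/funext => w; rewrite expRD !rmorphM/= mulrA.
  have -> : (fun x => b%:C * (expR (K x))%:C * Psi 1 0 x) =
      (fun x => (b * expR (K x))%:C * Psi 1 0 x).
    by apply/funext => x; rewrite rmorphM.
  apply: (ccond_version_pull_out (K := fun x => (b * expR (K x))%:C)
    (k := fun w => `|b| * expR (K (pi w))) (D := fun w => expR (A w))) XA => /=.
  - apply: measurable_funM => //; exact: (measurableT_comp (@measurable_expR R)).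
  - exact: measurable_cst.
  - by move=> w; rewrite normrM (ger0_norm (expR_ge0 _)).
  - by move=> w; rewrite normr0 mulr_ge0// expR_ge0.
  - by move=> w; rewrite ger0_norm ?expR_ge0.
  - by move=> w; rewrite normr0 expR_ge0.
  - rewrite (_ : (fun w => _) = (fun w => `|b|%:E * (expR (K (pi w) + A w))%:E)%E).
      exact: integrableZl.
    by apply/funext => w; rewrite -EFinM expRD mulrA.
have cva : ccond_version P pi (fun=> a%:C) (fun=> a%:C).
  exact/ccond_version_real/cond_version_cst.
have cvc : ccond_version P pi (fun w => c%:C * (expR (B w))%:C)
    (fun x => c%:C * (St x)%:C).
  have := ccond_version_real (cond_versionZ c BSt).
  by congr ccond_version; apply/funext => w; rewrite rmorphM.
have := ccond_versionD (ccond_versionD (ccond_versionD (ccond_versionD cva cvG) cvc) cv0) cv1.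
congr ccond_version; apply/funext => w /=.
- congr (_ + _ + _); congr cintegral; apply/funext => v.
    by rewrite cpow_line mulrDr expRD.
  by rewrite cpow_lineM -expRD !mulrDr !addrA.
- by congr (_ + _ + _); congr cintegral; apply/funext => v; rewrite /f0 /f1 cpow_line.
Qed.

End Pricing_formula.

(** * Sub-sigma-algebras as measurable maps *)

Section Sub_sigma_algebras.
Context {d : measure_display} {Om : measurableType d} {R : realType}.
Implicit Types (G : set (set Om)) (X Y : Om -> R).

Lemma sub_measurableS G1 G2 Y : G1 `<=` G2 ->
  sub_measurable G1 Y -> sub_measurable G2 Y.
Proof.
move=> G12 mY mT B mB; have := mY measurableT B mB.
exact: (sub_smallest2r (@smallest_sigma_algebra _ _ _)).
Qed.

Lemma sub_measurable_measurable G Y : G `<=` measurable ->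
  sub_measurable G Y -> measurable_fun setT Y.
Proof.
move=> Gm mY mT B mB; have := mY measurableT B mB.
apply: smallest_sub => //; exact: sigma_algebra_measurable.
Qed.

Lemma sub_sigma_algebra_map G : sigma_algebra setT G -> G `<=` measurable ->
  exists pi : {mfun Om >-> g_sigma_algebraType G}, forall w, pi w = w.
Proof.
move=> sG Gm.
have mid : measurable_fun setT (id : Om -> g_sigma_algebraType G).
  move=> _ B mB; rewrite setTI; apply: Gm.
  by move: mB; rewrite measurable_g_measurableTypeE.
pose f : Om -> g_sigma_algebraType G := id.
pose m := isMeasurableFun.Build _ _ _ _ f mid.
pose pi : {mfun Om >-> g_sigma_algebraType G} := HB.pack f m.
by exists pi.
Qed.

Variables (P : probability Om R) (G : set (set Om)).
Hypothesis sG : sigma_algebra setT G.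
Variable pi : {mfun Om >-> g_sigma_algebraType G}.
Hypothesis piE : forall w, pi w = w.

Let preimage_pi (A : set Om) : pi @^-1` A = A.
Proof. by apply/seteqP; split => w /=; rewrite piE. Qed.

Lemma is_cond_expP X Y : is_cond_exp P G X Y <->
  exists2 X', cond_version P pi X' Y & {ae P, forall w, X w = X' w}.
Proof.
split=> [[mY iY [X' [iX' XX' YE]]]|[X' [mY iX' iY YE] XX']].
  exists X' => //; split => //.
    by rewrite (_ : _ \o pi = EFin \o Y)//; apply/funext => w /=; rewrite piE.
  move=> A; rewrite measurable_g_measurableTypeE// => GA.
  by under eq_integral do rewrite piE; rewrite preimage_pi; exact: YE.
split => //.
  by rewrite (_ : EFin \o Y = EFin \o Y \o pi)//; apply/funext => w /=; rewrite piE.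
exists X'; split => // A GA.
have := YE A; rewrite measurable_g_measurableTypeE// => /(_ GA).
by under eq_integral do rewrite piE; rewrite preimage_pi.
Qed.

Lemma is_cond_exp_cond_version X X' Y : measurable_fun setT X' ->
  {ae P, forall w, X w = X' w} -> is_cond_exp P G X Y -> cond_version P pi X' Y.
Proof.
move=> mX' XX' /is_cond_expP[X'' XY XX''].
apply: cond_version_ae_left XY => //.
by apply: filterS2 XX' XX'' => w <- <-.
Qed.

Lemma cond_version_is_cond_exp X X' Y :
  {ae P, forall w, X w = X' w} -> cond_version P pi X' Y -> is_cond_exp P G X Y.
Proof. by move=> XX' XY; apply/is_cond_expP; exists X'. Qed.

End Sub_sigma_algebras.

Lemma measurable_powers {R : realType} {d : measure_display} {Om : measurableType d}
    (s u : R[i]) (A B : Om -> R) :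
  measurable_fun setT A -> measurable_fun setT B ->
  measurable_fun setT (fun w => complex.Re (cpow (expR (A w)) s * cpow (expR (B w)) u)) /\
  measurable_fun setT (fun w => complex.Im (cpow (expR (A w)) s * cpow (expR (B w)) u)).
Proof.
have mRe z (f : Om -> R) : measurable_fun setT f ->
    measurable_fun setT (fun w => complex.Re (cpow (expR (f w)) z)).
  move=> mf; under eq_fun do rewrite cpow_expR /=.
  apply: measurable_funM; last apply: (measurableT_comp measurable_cos).
    by apply: (measurableT_comp (@measurable_expR R)); exact: measurable_funM.
  exact: measurable_funM.
have mIm z (f : Om -> R) : measurable_fun setT f ->
    measurable_fun setT (fun w => complex.Im (cpow (expR (f w)) z)).
  move=> mf; under eq_fun do rewrite cpow_expR /=.
  apply: measurable_funM; last apply: (measurableT_comp measurable_sin).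
    by apply: (measurableT_comp (@measurable_expR R)); exact: measurable_funM.
  exact: measurable_funM.
move=> mA mB; split.
  under eq_fun do rewrite ReM.
  by apply: measurable_funB; apply: measurable_funM; [exact: mRe|exact: mRe|exact: mIm|exact: mIm].
under eq_fun do rewrite ImM.
by apply: measurable_funD; apply: measurable_funM; [exact: mRe|exact: mIm|exact: mIm|exact: mRe].
Qed.

(** * Integrability and conditioning of the price process *)

Section Price_process.
Context {R : realType} {d : measure_display} {Om : measurableType d}.
Variables (P : probability Om R) (T r : R) (F : R -> set (set Om)) (S : R -> Om -> R).
Hypotheses (T_gt0 : 0 < T) (r_ge0 : 0 <= r) (filtF : is_filtration F T).
Hypothesis adS : adapted F T S.
Hypothesis contS : continuous_paths P T S.
Hypothesis posS : {ae P, forall w, forall t : R, 0 <= t <= T -> 0 < S t w}.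
Hypothesis martS : martingale P F T (fun t w => expR (- r * t) * S t w).

Lemma price_measurable u : 0 <= u <= T -> measurable_fun setT (S u).
Proof.
move=> uT; have [_ Fm _] := filtF.
exact: sub_measurable_measurable (Fm u uT) (adS uT).
Qed.

Lemma price_sub_measurable u t : 0 <= u -> u <= t -> t <= T -> sub_measurable (F t) (S u).
Proof.
move=> u0 ut tT; have [_ _ Fmono] := filtF.
by apply: sub_measurableS (Fmono _ _ u0 ut tT) (adS _); rewrite u0 (le_trans ut).
Qed.

Lemma price_regular s : s <= T -> {ae P, forall w, regular_path s (S^~ w)}.
Proof.
move=> sT; apply: filterS2 contS posS => w cSw Sw; split; last first.
  by move=> u /andP[u0 us]; apply: Sw; rewrite u0 (le_trans us).
apply: continuous_subspaceW cSw => u /=; rewrite !in_itv /= => /andP[-> us].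
exact: le_trans sT.
Qed.

(** The discounted price has constant expectation [C0], which by positivity is also its L^1 norm.
    Undoing the discount costs at most the factor [exp (r * T)], as [r >= 0]. *)
Lemma price_bounded : exists C, forall u, 0 <= u <= T ->
  (\int[P]_w `|(S u w)%:E| <= C%:E)%E.
Proof.
have [_ iX ceX] := martS; have [sF _ _] := filtF.
have T0 : 0 <= (0 : R) <= T by rewrite lexx ltW.
pose C0 := fine (\int[P]_w (expR (- r * 0) * S 0 w)%:E)%E.
exists (expR (r * T) * C0) => u uT; have /andP[u0 uT'] := uT.
have mS := price_measurable uT.
have mX : measurable_fun setT (fun w => expR (- r * u) * S u w).
  exact: measurable_funM.
have XC : (\int[P]_w (expR (- r * u) * S u w)%:E = C0%:E)%E.
  rewrite fineK; last exact: integrable_fin_num (iX _ T0).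
  have [_ _ [X' [iX' XX' XE]]] := ceX _ _ (lexx 0) u0 uT'.
  have F0T : F 0 setT by have [] := sF _ T0; move=> /[dup] F0 _ /(_ _ F0); rewrite setD0.
  rewrite XE//; apply: ae_eq_integral => //.
  - exact/measurable_EFinP.
  - exact: measurable_int iX'.
  - by move: XX'; apply: filterS => w ->.
have normE : (\int[P]_w `|(S u w)%:E| = (expR (r * u) * C0)%:E)%E.
  rewrite EFinM -XC -integralZl//; last exact: iX.
  apply: ae_eq_integral => //.
  - by apply: measurableT_comp => //; exact/measurable_EFinP.
  - by apply/measurable_EFinP/measurable_funM.
  - move: posS; apply: filterS => w Sw _.
    by rewrite -EFinM mulrA -expRD mulNr subrr expR0 mul1r /= gtr0_norm// Sw.
have C0_ge0 : 0 <= C0.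
  rewrite -(pmulr_rge0 _ (expR_gt0 (r * u))) -lee_fin -normE.
  exact: integral_ge0.
by rewrite normE lee_fin ler_wpM2r// ler_expR ler_wpM2l.
Qed.

Lemma discounted_price_version t (pi : {mfun Om >-> g_sigma_algebraType (F t)}) :
  0 <= t <= T -> (forall w, pi w = w) ->
  cond_version P pi (S T) (fun w => expR (r * (T - t)) * S t w).
Proof.
move=> tT piE; have /andP[t0 tT'] := tT; have [_ _ ceX] := martS.
have [sF _ _] := filtF.
have mX : measurable_fun setT (fun w => expR (- r * T) * S T w).
  by apply: measurable_funM => //; apply: price_measurable; rewrite lexx ltW.
have := is_cond_exp_cond_version (sF t tT) piE mX (aeW _ (fun=> erefl))
  (ceX t T t0 tT' (lexx T)).
move=> /(cond_versionZ (expR (r * T))); congr cond_version; apply/funext => w.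
  by rewrite mulrA -expRD mulNr subrr expR0 mul1r.
by rewrite mulrA -expRD mulNr mulrBr.
Qed.

End Price_process.

(* The line S_rho is identified with R through y |-> rho + i y, so a Borel
   measure on S_rho is a Borel measure on R. *)
Theorem theorem3p2 (R : realType) (d : measure_display) (Om : measurableType d)
    (P : probability Om R) (T r : R) (F : R -> set (set Om))
    (S : R -> Om -> R) (g : probability (measurableTypeR R) R)
    (rho : R) (h : R -> R -> R) (a b c : R)
    (zeta0 zeta1 : complex_measure (measurableTypeR R) R)
    (T_gt0 : 0 < T) (r_ge0 : 0 <= r)
    (filtF : is_filtration F T)
    (contS : continuous_paths P T S)
    (semiS : semimartingale P F T S)
    (posS : {ae P, forall w, forall t : R, 0 <= t <= T -> 0 < S t w})
    (martS : martingale P F T (fun t w => expR (- r * t) * S t w))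
    (g0T : g `[0, T]%classic = 1%E)
    (rho01 : 0 < rho < 1)
    (hE : forall x y : R, 0 < x -> 0 < y ->
       let I0 := cintegral zeta0 (fun v => cpow x (rho +i* v)) in
       let I1 := cintegral zeta1
         (fun v => cpow x (rho +i* v) * cpow y (1 - (rho +i* v))) in
       [/\ complex.Im I0 = 0, complex.Im I1 = 0 &
           (h x y)%:C = a%:C + b%:C * x%:C + c%:C * y%:C + I0 + I1]) :
  forall t : R, 0 <= t <= T ->
  let G := geo_avg g S in
  let disc := expR (- r * (T - t)) in
  let is_cond_h := is_cond_exp P (F t) (fun w => h (G T w) (S T w)) in
  let is_Psi := psi_version P (F t) rho (geo_avg_tail g S t T) (S T) in
  [/\ exists V : Om -> R, is_cond_h V,
      exists Psi : R[i] -> R[i] -> Om -> R[i], is_Psi Psi &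
      forall (V : Om -> R) (Psi : R[i] -> R[i] -> Om -> R[i]),
        is_cond_h V -> is_Psi Psi ->
        {ae P, forall w,
          let f0 (v : R) := cpow (G t w) (rho +i* v) * Psi (rho +i* v) 0 w in
          let f1 (v : R) := cpow (G t w) (rho +i* v)
                      * Psi (rho +i* v) (1 - (rho +i* v)) w in
          [/\ cintegrable zeta0 f0, cintegrable zeta1 f1 &
              (disc * V w)%:C =
                disc%:C * a%:C
                + disc%:C * b%:C * (G t w)%:C * Psi 1 0 w
                + c%:C * (S t w)%:C
                + disc%:C * cintegral zeta0 f0
                + disc%:C * cintegral zeta1 f1]} ].
Proof.
move=> t tT G disc is_cond_h is_Psi; have /andP[t0 tT'] := tT.
have [adS _] := semiS.
have [sF Fm _] := filtF.
have [pi piE] := sub_sigma_algebra_map (sF t tT) (Fm t tT).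
have TT : 0 <= T <= T by rewrite lexx ltW.
have T_ge0 : 0 <= T by exact: ltW.
have mS u : 0 <= u <= T -> measurable_fun setT (S u).
  exact: (price_measurable filtF adS).
have mSt u : 0 <= u <= t ->
    measurable_fun setT (S u : g_sigma_algebraType (F t) -> R).
  by move=> /andP[u0 ut]; exact: (price_sub_measurable filtF adS).
have regT := price_regular contS posS (lexx T).
have [C SC] := price_bounded T_gt0 r_ge0 filtF adS posS martS.
have sub0t : `[0, t]%classic `<=` `[0, t]%classic by [].
have subtT : `]t, T]%classic `<=` `[0, T]%classic.
  move=> u /=; rewrite !in_itv/= => /andP[tu ->].
  by rewrite (le_trans t0 (ltW tu)).
(* [K] is built on [Om] equipped with [F t], hence is [F t]-measurable by construction, although the
   set of irregular paths need not belong to [F t]. *)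
have [K mK KE] := measurable_log_average g T_gt0 t0 tT' sub0t (measurable_itv _) mSt.
have [A mA AE] := measurable_log_average g T_gt0 T_ge0 (lexx T) subtT (measurable_itv _) mS.
pose B w := ln (S T w).
have mB : measurable_fun setT B by exact: (measurableT_comp (@measurable_ln R) (mS T TT)).
have GtE : {ae P, forall w : Om, G t w = expR (K w)}.
  apply: filterS (price_regular contS posS tT') => w rw.
  by rewrite /G /geo_avg KE.
have tailE : {ae P, forall w, geo_avg_tail g S t T w = expR (A w)}.
  by move: regT; apply: filterS => w rw; rewrite /geo_avg_tail AE.
have itvU : `[0, t]%classic `|` `]t, T]%classic = `[0, T]%classic :> set R.
  apply/seteqP; split => u /=; rewrite !in_itv/=.
    move=> [/andP[-> ut]|/andP[tu ->]]; first by rewrite (le_trans ut).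
    by rewrite (le_trans t0 (ltW tu)).
  move=> /andP[u0 uT]; have [ut|tu] := leP u t.
    by left; apply/andP.
  by right; apply/andP.
have KAE : {ae P, forall w : Om, K w + A w = \int[g]_(u in `[0, T]) ln (S u w)}.
  apply: filterS2 regT (price_regular contS posS tT') => w rw rtw.
  rewrite KE// AE// -Rintegral_setU ?itvU//.
  - exact: (integrable_continuous _ T_ge0 (@subset_refl _ _) (measurable_itv _)
      (continuous_ln_path rw)).
  - apply/disj_setPS => u [/=]; rewrite !in_itv/= => /andP[_ ut] /andP[tu _].
    by have := le_lt_trans ut tu; rewrite ltxx.
have GTE : {ae P, forall w : Om, G T w = expR (K w + A w)}.
  by apply: filterS KAE => w KAw; rewrite KAw.
have STE : {ae P, forall w, S T w = expR (B w)}.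
  by move: posS; apply: filterS => w Sw; rewrite lnK// posrE Sw.
have iA : P.-integrable setT (fun w => (expR (A w))%:E).
  apply: (integrable_geometric_average (g := g) T_gt0 T_ge0 (lexx T) subtT
    (measurable_itv _) mS SC regT mA).
  by move: regT; apply: filterS => w /AE.
have mKO : measurable_fun setT (K : Om -> R).
  exact: sub_measurable_measurable (Fm t tT) mK.
have mKA : measurable_fun setT (fun w : Om => K w + A w) by exact: measurable_funD.
have iKA : P.-integrable setT (fun w => (expR (K (pi w) + A w))%:E).
  under eq_fun do rewrite piE.
  exact: (integrable_geometric_average (g := g) T_gt0 T_ge0 (lexx T) (@subset_refl _ _)
    (measurable_itv _) mS SC regT mKA KAE).
have BSt : cond_version P pi (fun w => expR (B w)) (fun w => expR (r * (T - t)) * S t w).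
  apply: cond_version_ae_left (discounted_price_version T_gt0 filtF adS martS tT piE) => //.
  exact: (measurableT_comp (@measurable_expR R)).
(* The two notions concern the same functions [Psi]; only the conditioned variables differ, and they
   agree off a null set. *)
have psiP Psi : is_Psi Psi <-> power_versions P pi rho A B Psi.
  have powE s u : {ae P, forall w, cpow (geo_avg_tail g S t T w) s * cpow (S T w) u
      = cpow (expR (A w)) s * cpow (expR (B w)) u}.
    by apply: filterS2 tailE STE => w -> ->.
  have reE s u : {ae P, forall w,
      complex.Re (cpow (geo_avg_tail g S t T w) s * cpow (S T w) u)
      = complex.Re (cpow (expR (A w)) s * cpow (expR (B w)) u)}.
    by apply: filterS (powE s u) => w ->.
  have imE s u : {ae P, forall w,
      complex.Im (cpow (geo_avg_tail g S t T w) s * cpow (S T w) u)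
      = complex.Im (cpow (expR (A w)) s * cpow (expR (B w)) u)}.
    by apply: filterS (powE s u) => w ->.
  split=> -[PsiE mPsi0 mPsi1]; split => // s u /PsiE[re im]; split.
  - have [mre _] := measurable_powers s u mA mB.
    exact: (is_cond_exp_cond_version (sF t tT) piE mre (reE s u) re).
  - have [_ mim] := measurable_powers s u mA mB.
    exact: (is_cond_exp_cond_version (sF t tT) piE mim (imE s u) im).
  - exact: (cond_version_is_cond_exp (sF t tT) piE (reE s u) re).
  - exact: (cond_version_is_cond_exp (sF t tT) piE (imE s u) im).
pose HC w := let x := expR (K (pi w) + A w) in let y := expR (B w) in
  a%:C + b%:C * x%:C + c%:C * y%:C
  + cintegral zeta0 (fun v => cpow x (rho +i* v))
  + cintegral zeta1 (fun v => cpow x (rho +i* v) * cpow y (1 - (rho +i* v))).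
have hHC : {ae P, forall w, (h (G T w) (S T w))%:C = HC w}.
  apply: filterS2 GTE STE => w Gw Sw.
  rewrite Gw Sw /HC piE; have [_ _ ->] := hE _ _ (expR_gt0 (K w + A w)) (expR_gt0 (B w)).
  by [].
(* Some [Psi0] is fixed beforehand because it yields the integrability of [HC]. From this come the
   existence of [V] and the measurability used to compare an arbitrary [V] with the formula. *)
have [Psi0 Psi0P] := power_versions_ex rho01 mA mB iA BSt.
have main Psi := @ccond_version_payoff _ _ _ _ _ P pi rho A B K _
  rho01 mA mB mK iKA BSt zeta0 zeta1 a b c Psi.
have [_ HC0] := main _ Psi0P.
have mHCr : measurable_fun setT (fun w => complex.Re (HC w)).
  by case: HC0 => -[_ /measurable_int/measurable_EFinP].
have mHCi : measurable_fun setT (fun w => complex.Im (HC w)).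
  by case: HC0 => _ [_ /measurable_int/measurable_EFinP].
have hRe : {ae P, forall w, h (G T w) (S T w) = complex.Re (HC w)}.
  by move: hHC; apply: filterS => w <-.
have hIm : {ae P, forall w, 0 = complex.Im (HC w)}.
  by move: hHC; apply: filterS => w <-.
split.
- have VP := cond_version_is_cond_exp (sF t tT) piE hRe HC0.1.
  exact: (ex_intro _ _ VP).
- by exists Psi0; apply/psiP.
move=> V Psi VP /psiP PsiP.
(* The imaginary part of [HC] vanishes almost surely, so 0 is a version of its conditional
   expectation. Uniqueness then identifies [V] with the explicit version given by [Psi]. *)
have VC : ccond_version P pi HC (fun w => (V w)%:C).
  split; first exact: (is_cond_exp_cond_version (sF t tT) piE mHCr hRe VP).
  apply: cond_version_ae_left hIm _ => //; exact: cond_version_cst.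
have [aeI cvI] := main _ PsiP.
apply: filterS2 (filterI aeI (ccond_version_unique VC cvI)) GtE => w [[I0 I1] VE] GtEw.
move: I0 I1 VE; rewrite !piE -GtEw => I0 I1 VE; split => //.
rewrite rmorphM/= VE 4!mulrDr; congr (_ + _ + _ + _ + _).
- by rewrite !mulrA.
- rewrite -!rmorphM /=; congr (_%:C).
  (* The discount cancels the growth factor of [E[S_T | F_t]], which leaves [c S_t] undiscounted. *)
  have discK : disc * expR (r * (T - t)) = 1 by rewrite -expRD mulNr addNr expR0.
  by rewrite mulrCA [disc * _]mulrA discK mul1r.
Qed.
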